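(* Let $\Sigma$ be a finite alphabet, let $h:\Sigma^*\to\Sigma^*$ be a nonerasing morphism prolongable on $w_0$, and let $\mathbf w=w_0w_1w_2\cdots=h^\omega(w_0)$. Let $\Delta\subsetneq\Sigma$ be a nonempty subalphabet such that $\mathbf w$ contains infinitely many letters of $\overline{\Delta}=\Sigma\setminus\Delta$ and $\Delta$-blocks of unbounded length. For $k\ge0$ let $(i_k,j_k)$ denote the starting and ending positions of the $k$-th maximal $\Delta$-block in $\mathbf w$. Then $\limsup_{k\to\infty}j_k/i_k$ is an algebraic number of degree at most $|\Sigma|$. If moreover $h$ is uniform, then $\limsup_{k\to\infty}j_k/i_k$ is rational.
   Context: Positions are indexed from $0$. A morphism is nonerasing if $h(c)\neq\epsilon$ for every letter $c$; it is uniform if $|h(c)|$ is the same for all letters; it is prolongable on $a$ if $h(a)=ax$ with $x$ nonempty (and $h^n(x)$ nonempty for all $n$), in which case $h^\omega(a)=a\,x\,h(x)h^2(x)\cdots$ is its infinite fixed point. A factor $w_i\cdots w_j$ ($i\le j$) of $\mathbf w$ is a $\Delta$-block if all its letters lie in $\Delta$; it is a maximal $\Delta$-block if moreover $w_{j+1}\in\overline\Delta$ and either $i=0$ or $w_{i-1}\in\overline\Delta$. Maximal $\Delta$-blocks are enumerated in increasing order of position. *)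

(* Defs.v *)
From Stdlib Require Import Reals ZArith.
From mathcomp Require Import all_boot.
Local Close Scope Z_scope.
Local Open Scope nat_scope.

Set Implicit Arguments.
Unset Strict Implicit.
Unset Printing Implicit Defensive.

Definition morph_word (Sigma : Type) (h : Sigma -> seq Sigma) (s : seq Sigma)
  : seq Sigma := flatten (map h s).

Definition morph_iter (Sigma : Type) (h : Sigma -> seq Sigma) (n : nat)
  (s : seq Sigma) : seq Sigma := iter n (morph_word h) s.

Definition nonerasing (Sigma : Type) (h : Sigma -> seq Sigma) : Prop :=
  forall c, h c <> [::].

Definition uniform_morph (Sigma : Type) (h : Sigma -> seq Sigma) : Prop :=
  exists m, forall c, size (h c) = m.

Definition prolongable (Sigma : Type) (h : Sigma -> seq Sigma) (a : Sigma)
  : Prop :=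
  exists x, h a = a :: x /\ x <> [::] /\
            forall n, morph_iter h n x <> [::].

(* The infinite fixed point h^omega(a): for a prolongable morphism,
   h^(n+1)(a) has length >= n+1 and is a prefix of h^omega(a), so
   letter n of h^omega(a) is letter n of h^(n+1)(a). *)
Definition fixpoint_word (Sigma : Type) (h : Sigma -> seq Sigma) (a : Sigma)
  (n : nat) : Sigma :=
  nth a (morph_iter h n.+1 [:: a]) n.

Definition max_block (Sigma : finType) (w : nat -> Sigma) (Delta : {set Sigma})
  (i j : nat) : Prop :=
  i <= j /\ (forall t, i <= t <= j -> w t \in Delta) /\
  w j.+1 \notin Delta /\ (i = 0 \/ w i.-1 \notin Delta).

Definition enum_max_blocks (Sigma : finType) (w : nat -> Sigma)
  (Delta : {set Sigma}) (i j : nat -> nat) : Prop :=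
  (forall k, i k < i k.+1) /\
  (forall k, max_block w Delta (i k) (j k)) /\
  (forall m n, max_block w Delta m n -> exists k, i k = m /\ j k = n).

Local Open Scope R_scope.

Definition is_limsup (u : nat -> R) (L : R) : Prop :=
  forall eps, eps > 0 ->
    (exists N, forall n, (N <= n)%nat -> u n < L + eps) /\
    (forall N, exists n, (N <= n)%nat /\ u n > L - eps).

Definition algebraic_deg_le (x : R) (d : nat) : Prop :=
  exists c : nat -> Z,
    (exists k, (k <= d)%nat /\ c k <> 0%Z) /\
    sum_f_R0 (fun k => IZR (c k) * x ^ k) d = 0.

Definition is_rational (x : R) : Prop :=
  exists p q : Z, q <> 0%Z /\ x = IZR p / IZR q.

(* Main.v *)
Require Import Defs.
From Stdlib Require Import Reals ZArith.
From mathcomp Require Import all_boot all_order all_algebra.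
From mathcomp Require Import complex Rstruct ssrZ.
From mathcomp Require Import ring zify.
From Stdlib Require Import Classical Lra.
Local Close Scope Z_scope.

Set Implicit Arguments.
Unset Strict Implicit.
Unset Printing Implicit Defensive.
Import Order.TTheory GRing.Theory Num.Theory.

(** Replace [h] by a power [g] for which the first and last letter of [g c]
    outside any given subalphabet are the same as for [g (g c)].  Let [D] be
    the set of letters [c] with [g c] in [Delta^*].  Every long maximal
    [Delta]-block is the image of a gap between consecutive letters outside
    [D], and such gaps descend, under iteration of [g], from gaps of bounded
    length.  Along one line of descent both ends are, up to a constant, of the
    form [|g^n(u)| + sum_(k < n) |g^k(y)|].  A line of descent starting far
    from the origin has ratio uniformly close to 1, because its letters occur
    many times to its left; hence the limsup is 1 or the largest of finitely
    many limits along lines of descent.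

    Each of these limits exists: by the choice of [g], iterated forward
    differences of [|g^n(c)|] are eventually nonnegative, so the corresponding
    recurrence has a dominant root [lam], unique on its circle, and the
    sequences grow like [c * 'C(n, d) * lam ^ n].  The ratio of two such
    constants lies in Q(lam), where [lam] is 1 or a root of a rational
    polynomial of degree at most the size of the alphabet. *)

(** * Linear recurrences and their asymptotics *)

Local Open Scope ring_scope.

(** For a power chosen carelessly the ratios along a line of descent can oscillate, because several
    roots may share the dominant circle. Stability of first letters is imposed for all subalphabets
    at once, for two reasons: [D] is itself defined from [g], and complements of singletons make
    [g c] and [g (g c)] have the same letters. Occurrence of a letter in an image is then
    transitive, which is what yields nonnegative differences. [Delta] need not equal its preimage
    under [g], but [D] does; descent therefore runs among [D]-gaps, and [Delta] enters only in the
    last image. Summation along a line adds a factor ['X - 1] to the recurrence. Its root 1 is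
    rational and is treated apart, so the degree bound stays at the size of the alphabet. If all
    images have length [m], the polynomial ['X - m] replaces the general one and [lam] is
    rational. *)

Section Act.
Variable R : comNzRingType.
Implicit Types (p q : {poly R}) (f : nat -> R).

(* The polynomial [p] in the shift operator, applied to [f]. *)
Definition act p f (n : nat) : R := \sum_(k < size p) p`_k * f (n + k)%N.

Lemma act_wide N p f n : (size p <= N)%N ->
  act p f n = \sum_(k < N) p`_k * f (n + k)%N.
Proof.
move=> le_pN; rewrite /act (big_ord_widen N (fun k => p`_k * f (n + k)%N) le_pN).
rewrite big_mkcond; apply: eq_bigr => k _; case: ltnP => // le_pk.
by rewrite nth_default // mul0r.
Qed.

Lemma eq_act p f g : f =1 g -> act p f =1 act p g.
Proof. by move=> eq_fg n; apply: eq_bigr => k _; rewrite eq_fg. Qed.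

Lemma actD p q f n : act (p + q) f n = act p f n + act q f n.
Proof.
set N := maxn (size p) (size q).
rewrite !(@act_wide N) ?leq_maxl ?leq_maxr ?size_polyD // -big_split /=.
by apply: eq_bigr => k _; rewrite coefD mulrDl.
Qed.

Lemma actZ c p f n : act (c *: p) f n = c * act p f n.
Proof.
rewrite (@act_wide (size p)) ?size_scale_leq // /act big_distrr /=.
by apply: eq_bigr => k _; rewrite coefZ mulrA.
Qed.

Lemma actC c f n : act c%:P f n = c * f n.
Proof.
by rewrite (@act_wide 1) ?size_polyC_leq1 // big_ord1 coefC /= addn0.
Qed.

Lemma act1 f n : act 1 f n = f n.
Proof. by rewrite -polyC1 actC mul1r. Qed.

Lemma actXM p f n : act ('X * p) f n = act p f n.+1.
Proof.
rewrite (@act_wide (size p).+1); last first.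
  by rewrite (leq_trans (size_polyMleq _ _)) // size_polyX.
rewrite big_ord_recl /= coefXM /= mul0r add0r; apply: eq_bigr => k _.
by rewrite coefXM /= addnS addSn.
Qed.

Lemma actN p f n : act (- p) f n = - act p f n.
Proof. by rewrite -scaleN1r actZ mulN1r. Qed.

Lemma actB p q f n : act (p - q) f n = act p f n - act q f n.
Proof. by rewrite actD actN. Qed.

Lemma actXsubC c f n : act ('X - c%:P) f n = f n.+1 - c * f n.
Proof. by rewrite actB actC -['X]mulr1 actXM act1. Qed.

Lemma act_shift p f m n : act p (fun k => f (m + k)%N) n = act p f (m + n)%N.
Proof. by apply: eq_bigr => k _; rewrite addnA. Qed.

Lemma actM p q f n : act (p * q) f n = act p (act q f) n.
Proof.
elim/poly_ind: p n => [|p c IHp] n.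
  by rewrite mul0r -polyC0 !actC !mul0r.
rewrite mulrDl !actD mul_polyC actZ actC; congr (_ + _).
rewrite [p * 'X]mulrC -mulrA !actXM; exact: IHp.
Qed.

Lemma act_add p f g n : act p (fun k => f k + g k) n = act p f n + act p g n.
Proof. by rewrite -big_split; apply: eq_bigr => k _; rewrite mulrDr. Qed.

Lemma act_geom p c x n : act p (fun k => c * x ^+ k) n = p.[x] * (c * x ^+ n).
Proof.
rewrite horner_coef big_distrl /=; apply: eq_bigr => k _.
by rewrite exprD; ring.
Qed.

Definition kills p f := forall n, act p f n = 0.

Lemma killsM p q f : kills q f -> kills (p * q) f.
Proof.
move=> kq n; rewrite actM (@eq_act p _ (fun=> 0)) // /act big1 // => k _.
by rewrite mulr0.
Qed.

(** The coefficient of ['C(m, n)] in Newton's expansion of [f m]. *)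
Definition fwd_diff f n := act (('X - 1%:P) ^+ n) f 0.

End Act.

(** * Limits of sequences in a closed numeric field *)

Section Limits.
Variable C : numClosedFieldType.
(** A numeric closed field need not be archimedean; the results are applied to [R[i]], through
    [complex_arch]. *)
Hypothesis arch : forall x : C, exists n : nat, `|x| < n%:R.

Definition tends (u : nat -> C) (l : C) :=
  forall e, 0 < e -> exists N, forall n, (N <= n)%N -> `|u n - l| < e.

Lemma tends_ext u v l : (forall n, u n = v n) -> tends u l -> tends v l.
Proof.
by move=> uv ul e /ul[N HN]; exists N => n /HN; rewrite uv.
Qed.

Lemma tends_cst l : tends (fun=> l) l.
Proof. by move=> e e0; exists 0%N => n _; rewrite subrr normr0. Qed.

Lemma tends_sub u l : tends u l <-> tends (fun n => u n - l) 0.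
Proof.
by split=> ul e /ul[N HN]; exists N => n /HN; rewrite subr0.
Qed.

Lemma tendsD u v l m : tends u l -> tends v m -> tends (fun n => u n + v n) (l + m).
Proof.
move=> ul vm e e0; have e2 : 0 < e / 2%:R by rewrite divr_gt0 ?ltr0n.
have [[N1 H1] [N2 H2]] := (ul _ e2, vm _ e2); exists (maxn N1 N2) => n.
rewrite geq_max => /andP[/H1 h1 /H2 h2].
rewrite opprD addrACA (le_lt_trans (ler_normD _ _)) //.
by rewrite [e]splitr ltrD.
Qed.

Lemma tends_bounded u l : tends u l -> exists2 M, 0 < M & forall n, `|u n| <= M.
Proof.
move=> /(_ 1 ltr01)[N HN].
exists (\sum_(k < N) `|u k| + (`|l| + 1)).
  by rewrite ltr_wpDl ?sumr_ge0 // ltr_wpDl.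
move=> n; have [le_Nn | lt_nN] := leqP N n.
  rewrite ler_wpDl ?sumr_ge0 // -{1}[u n](subrK l) addrC.
  by rewrite (le_trans (ler_normD _ _)) // lerD2l ltW // HN.
rewrite (bigD1 (Ordinal lt_nN)) //= -addrA lerDl addr_ge0 ?sumr_ge0 //.
by rewrite addr_ge0.
Qed.

Lemma null_mul u v M : tends u 0 -> (forall n, `|v n| <= M) ->
  tends (fun n => u n * v n) 0.
Proof.
move=> u0 vM e e0; have M0 : 0 <= M by apply: le_trans (vM 0%N).
have [N HN] := u0 (e / (M + 1)) (divr_gt0 e0 (ltr_wpDl M0 ltr01)).
exists N => n /HN; rewrite !subr0 normrM => lt_u.
have M1 : 0 < M + 1 by rewrite ltr_wpDl.
rewrite -[e](divfK (lt0r_neq0 M1)); apply: (@le_lt_trans _ _ (`|u n| * (M + 1))).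
  by rewrite ler_wpM2l // (le_trans (vM n)) // lerDl.
by rewrite ltr_pM2r.
Qed.

Lemma tends_null_dom u v : (forall n, `|u n| <= `|v n|) -> tends v 0 -> tends u 0.
Proof.
move=> uv v0 e /v0[N HN]; exists N => n /HN; rewrite !subr0.
exact: le_lt_trans.
Qed.

Lemma tendsM u v l m : tends u l -> tends v m -> tends (fun n => u n * v n) (l * m).
Proof.
move=> ul vm; apply/tends_sub.
have [M _ vM] := tends_bounded vm.
have A := null_mul (proj1 (tends_sub _ _) ul) vM.
have B := @null_mul _ (fun=> l) `|l| (proj1 (tends_sub _ _) vm) (fun=> lexx _).
have := tendsD A B; rewrite addr0; apply: tends_ext => n; ring.
Qed.

Lemma tendsV u l : tends u l -> l != 0 -> tends (fun n => (u n)^-1) l^-1.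
Proof.
move=> ul l0; have nl0 : 0 < `|l| by rewrite normr_gt0.
have l2 : 0 < `|l| / 2%:R by rewrite divr_gt0 ?ltr0n.
have [N HN] := ul _ l2.
have low n : (N <= n)%N -> `|l| / 2%:R <= `|u n|.
  move=> /HN /ltW lt; rewrite -(lerD2r (`|l| / 2%:R)) -splitr.
  apply: le_trans (lerD (lexx _) lt); rewrite addrC distrC.
  by rewrite -{1}[l](subrK (u n)) ler_normD.
move=> e e0; have [|N2 HN2] := ul (e * (`|l| * (`|l| / 2%:R))).
  by rewrite !mulr_gt0 ?invr_gt0 ?ltr0n.
exists (maxn N N2) => n; rewrite geq_max => /andP[/low un /HN2 un2].
have un0 : 0 < `|u n| by apply: lt_le_trans un.
have un00 : u n != 0 by rewrite -normr_gt0.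
have -> : (u n)^-1 - l^-1 = (l - u n) / (l * u n).
  by field; rewrite un00 l0.
rewrite normrM normfV normrM distrC ltr_pdivrMr ?mulr_gt0 //.
by apply: lt_le_trans un2 _; rewrite ler_pM2l // ler_pM2l.
Qed.

Lemma tends_shift u l m : tends u l -> tends (fun n => u (n + m)%N) l.
Proof.
by move=> ul e /ul[N HN]; exists N => n le; apply: HN; rewrite (leq_trans le) ?leq_addr.
Qed.

Lemma tends_unshift u l m : tends (fun n => u (n + m)%N) l -> tends u l.
Proof.
move=> ul e /ul[N HN]; exists (N + m)%N => n le.
by rewrite -(subnK (leq_trans (leq_addl _ _) le)); apply: HN; rewrite leq_subRL ?(leq_trans (leq_addl _ _) le) // addnC.
Qed.

Lemma tends_uniq u l m : tends u l -> tends u m -> l = m.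
Proof.
move=> ul um; apply/eqP; rewrite -subr_eq0; apply/negPn/negP => lm0.
have e0 : 0 < `|l - m| / 2%:R by rewrite divr_gt0 ?ltr0n ?normr_gt0.
have [[N1 H1] [N2 H2]] := (ul _ e0, um _ e0).
have := ltrD (H1 _ (leq_maxl N1 N2)) (H2 _ (leq_maxr N1 N2)).
rewrite -splitr distrC => /(le_lt_trans (ler_normD _ _)).
by rewrite addrA subrK ltxx.
Qed.

Lemma expr_bernoulli (x : C) n : 0 <= x -> 1 + n%:R * x <= (1 + x) ^+ n.
Proof.
move=> x0; elim: n => [|n IHn]; first by rewrite mul0r addr0 expr0.
rewrite exprS; apply: (@le_trans _ _ ((1 + x) * (1 + n%:R * x))).
  rewrite -subr_ge0; have -> : (1 + x) * (1 + n%:R * x) - (1 + n.+1%:R * x) = n%:R * (x * x).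
    by rewrite -natr1; ring.
  by rewrite mulr_ge0 // mulr_ge0.
by rewrite ler_pM2l // ltr_wpDr.
Qed.

Lemma expr_unbounded (x M : C) : 1 < x -> M \is Num.real -> exists n, M < x ^+ n.
Proof.
move=> x1 Mr; have y0 : 0 < x - 1 by rewrite subr_gt0.
have [n Hn] := arch (M / (x - 1)); exists n.
have := @expr_bernoulli (x - 1) n (ltW y0); rewrite subrKC.
apply: lt_le_trans; apply: (@le_lt_trans _ _ (n%:R * (x - 1))).
  rewrite -ler_pdivrMr //; apply: le_trans (ltW Hn).
  by rewrite real_ler_norm // rpredM // rpredV // gtr0_real.
by rewrite ltr_pwDl.
Qed.

Lemma tends_geom (mu : C) : `|mu| < 1 -> tends (fun n => mu ^+ n) 0.
Proof.
move=> mu1 e e0; have [-> | mu0] := eqVneq mu 0.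
  by exists 1%N => -[//|n] _; rewrite expr0n subr0 normr0.
have nm0 : 0 < `|mu| by rewrite normr_gt0.
have [||N HN] := @expr_unbounded `|mu|^-1 e^-1.
- by rewrite invf_gt1.
- by rewrite realV gtr0_real.
exists N => n le_Nn.
rewrite subr0 normrX; apply: (@le_lt_trans _ _ (`|mu| ^+ N)).
  by rewrite ler_wiXn2l // ltW.
by rewrite -[X in _ < X]invrK -[X in X < _]invrK ltf_pV2 ?posrE ?invr_gt0 ?exprn_gt0 // -exprVn.
Qed.

(* The error contracts by the factor [|mu| < 1] up to a null perturbation. *)
Lemma null_affine_rec (mu : C) (v w : nat -> C) : `|mu| < 1 ->
  (forall n, v n.+1 = mu * v n + w n) -> tends w 0 -> tends v 0.
Proof.
move=> mu1 rec w0 e e0; have d0 : 0 < 1 - `|mu| by rewrite subr_gt0.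
have e2 : 0 < e / 2%:R by rewrite divr_gt0 ?ltr0n.
have [N HN] := w0 _ (mulr_gt0 d0 e2).
have bnd k : `|v (N + k)%N| <= `|mu| ^+ k * `|v N| + e / 2%:R.
  elim: k => [|k IHk]; first by rewrite addn0 expr0 mul1r lerDl ltW.
  rewrite addnS rec (le_trans (ler_normD _ _)) // normrM.
  have /ltW := HN (N + k)%N (leq_addr _ _); rewrite subr0 => hw.
  apply: le_trans (lerD (ler_wpM2l (normr_ge0 mu) IHk) hw) _.
  by rewrite exprS le_eqVlt; apply/orP; left; apply/eqP; ring.
have g0 := null_mul (tends_geom mu1) (fun=> lexx `|v N|).
have [N2 HN2] := g0 _ e2.
exists (N + N2)%N => n le; rewrite subr0 -(subnKC (leq_trans (leq_addr _ _) le)).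
apply: le_lt_trans (bnd _) _; rewrite [X in _ < X]splitr ltrD2r.
have := HN2 (n - N)%N; rewrite subr0 normrM normrX => -> //.
by rewrite leq_subRL // (leq_trans (leq_addr _ _) le).
Qed.

Lemma tends_affine_rec (mu : C) (v w : nat -> C) c : `|mu| < 1 ->
  (forall n, v n.+1 = mu * v n + w n) -> tends w c -> tends v (c / (1 - mu)).
Proof.
move=> mu1 rec wc; have m0 : 1 - mu != 0.
  by apply/negP; rewrite subr_eq0 => /eqP e; rewrite -e normr1 ltxx in mu1.
apply/tends_sub; apply: (@null_affine_rec mu _ (fun n => w n - c)) => //.
  by move=> n; rewrite rec; field.
exact: (proj1 (tends_sub _ _) wc).
Qed.

Lemma leq_bin_add n d : (n <= 'C(n + d, d.+1))%N.
Proof.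
elim: n => // n IHn; rewrite addSn binS -addn1 leq_add //.
by rewrite bin_gt0 leq_addl.
Qed.

Lemma tends_binV d : tends (fun n => 'C(n, d.+1)%:R^-1 : C) 0.
Proof.
move=> e e0; have [N] := arch e^-1; rewrite normfV gtr0_norm // => HN.
exists (N + d)%N => n le; rewrite subr0.
have le' := leq_trans (leq_addl _ _) le.
have hC : (N <= 'C(n, d.+1))%N.
  rewrite -(subnK le'); apply: leq_trans (leq_bin_add _ _).
  by rewrite leq_subRL // addnC.
have hC' : e^-1 < 'C(n, d.+1)%:R by apply: lt_le_trans HN _; rewrite ler_nat.
have C0 : (0 : C) < 'C(n, d.+1)%:R by apply: lt_trans hC'; rewrite invr_gt0.
by rewrite normfV gtr0_norm // -[e]invrK ltf_pV2 ?posrE ?invr_gt0.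
Qed.

(* Stolz-Cesaro against the exact sums [sum_(k < n) 'C(k, d) = 'C(n, d.+1)]. *)
Lemma null_sum_bin (u v : nat -> C) d : (forall n, u n.+1 = u n + v n) ->
  tends (fun n => v n / 'C(n, d)%:R) 0 -> tends (fun n => u n / 'C(n, d.+1)%:R) 0.
Proof.
move=> rec v0 e e0; have e2 : 0 < e / 2%:R by rewrite divr_gt0 ?ltr0n.
have [N HN] := v0 _ e2; set M := maxn N d.
have bnd k : `|u (M + k)%N| <= `|u M| + e / 2%:R * 'C(M + k, d.+1)%:R.
  elim: k => [|k IHk]; first by rewrite addn0 lerDl mulr_ge0 // ltW.
  rewrite addnS rec (le_trans (ler_normD _ _)) //.
  rewrite binS natrD mulrDr addrA lerD //.
  have C0 : (0 : C) < 'C(M + k, d)%:R.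
    by rewrite ltr0n bin_gt0 (leq_trans (leq_maxr N d)) ?leq_addr.
  have := HN (M + k)%N (leq_trans (leq_maxl _ _) (leq_addr _ _)).
  by rewrite subr0 normf_div [`|'C(_,_)%:R|]gtr0_norm // ltr_pdivrMr // => /ltW.
have g0 := null_mul (tends_binV d) (fun=> lexx `| `|u M| : C |).
have [N2 HN2] := g0 _ e2.
exists (M + N2 + d.+1)%N => n le; rewrite subr0.
have leM : (M <= n)%N by apply: leq_trans le; rewrite -addnA leq_addr.
have C0 : (0 : C) < 'C(n, d.+1)%:R.
  by rewrite ltr0n bin_gt0 (leq_trans (leq_addl _ _) le).
rewrite normf_div [`|'C(_,_)%:R|]gtr0_norm // ltr_pdivrMr //.
have := bnd (n - M)%N; rewrite subnKC // => /le_lt_trans; apply.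
rewrite {2}[e]splitr mulrDl ltrD2r -ltr_pdivrMr //.
have := HN2 n; rewrite subr0 normrM normr_id normfV [`|'C(_,_)%:R|]gtr0_norm // mulrC; apply.
by apply: leq_trans le; rewrite addnAC leq_addl.
Qed.

Lemma tends_sum_bin (u v : nat -> C) d c : (forall n, u n.+1 = u n + v n) ->
  tends (fun n => v n / 'C(n, d)%:R) c -> tends (fun n => u n / 'C(n, d.+1)%:R) c.
Proof.
move=> rec vc; apply/tends_sub.
have H : tends (fun n => (u n - c * 'C(n, d.+1)%:R) / 'C(n, d.+1)%:R) 0.
  apply: (@null_sum_bin _ (fun n => v n - c * 'C(n, d)%:R)).
    by move=> n; rewrite rec binS natrD; ring.
  (* ['C(n, d)] vanishes for [n < d], so the quotients simplify only from [d] on. *)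
  apply: (@tends_unshift _ _ d); have := tends_shift d (proj1 (tends_sub _ _) vc).
  apply: tends_ext => n; field; by rewrite pnatr_eq0 -lt0n bin_gt0 leq_addl.
apply: (@tends_unshift _ _ d.+1); have := tends_shift d.+1 H.
apply: tends_ext => n; field; by rewrite pnatr_eq0 -lt0n bin_gt0 leq_addl.
Qed.

Lemma tends_bin_geom (q : C) d : `|q| < 1 -> tends (fun n => 'C(n, d)%:R * q ^+ n) 0.
Proof.
move=> q1; elim: d => [|d IHd].
  by apply: tends_ext (tends_geom q1) => n; rewrite bin0 mul1r.
apply: (@null_affine_rec q _ (fun n => q * ('C(n, d)%:R * q ^+ n))) => //.
  by move=> n; rewrite binS natrD exprS; ring.
by have := tendsM (tends_cst q) IHd; rewrite mulr0.
Qed.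

End Limits.

(** * Dominant roots of nonnegative recurrent sequences *)

Section Dominance.
Variable C : numClosedFieldType.
Hypothesis arch : forall x : C, exists n : nat, `|x| < n%:R.

Implicit Types (f a : nat -> C) (rs : seq C).

Definition nnegp (p : {poly C}) := forall j, 0 <= p`_j.

Lemma nnegpM p q : nnegp p -> nnegp q -> nnegp (p * q).
Proof. by move=> p0 q0 j; rewrite coefM sumr_ge0 // => i _; rewrite mulr_ge0. Qed.

(** On the unit circle [1 - 'Re (z ^+ 2)] is [2 * (1 - 'Re z) * (1 + 'Re z)]. While real parts stay
    positive, squaring at least doubles [1 - 'Re z], which would nevertheless remain below 1. *)
Lemma unit_doubling (u : C) : `|u| = 1 -> ~~ (0 <= u) ->
  exists m, 'Re (u ^+ (2 ^ m)) <= 0.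
Proof.
move=> u1 u0; apply: NNPP => no.
have pos m : 0 < 'Re (u ^+ (2 ^ m)).
  rewrite real_ltNge ?Creal_Re ?real0 //; apply/negP => h; apply: no; by exists m.
have dbl z : `|z| = 1 -> 1 - 'Re (z ^+ 2) = 2%:R * (1 - 'Re z) * (1 + 'Re z).
  move=> z1; have zz : z * z^* = 1 by rewrite -normCK z1 expr1n.
  rewrite !ReE rmorphXn /= -[X in X - _]zz; have := zz; move: (z^*) => y zy.
  have -> : 2%:R * (1 - (z + y) / 2%:R) * (1 + (z + y) / 2%:R) =
    2%:R * (z * y) - (z ^+ 2 + 2%:R * (z * y) + y ^+ 2) / 2%:R by rewrite {1}zy; field.
  by field.
have nrm m : `|u ^+ (2 ^ m)| = 1 by rewrite normrX u1 expr1n.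
have grow m : (2 ^ m)%:R * (1 - 'Re u) <= 1 - 'Re (u ^+ (2 ^ m)).
  elim: m => [|m IH]; first by rewrite mul1r expr1.
  have -> : u ^+ (2 ^ m.+1) = (u ^+ (2 ^ m)) ^+ 2 by rewrite -exprM expnSr.
  rewrite dbl // expnS natrM -!mulrA ler_pM2l ?ltr0n //.
  apply: le_trans IH _; rewrite ler_peMr ?lerDl ?(ltW (pos m)) //.
  by rewrite subr_ge0 -(nrm m) leif_Re_Creal.
have t0 : 0 < 1 - 'Re u.
  by rewrite subr_gt0 -u1 lt_neqAle !leif_Re_Creal andbT.
have [n Hn] := arch (1 - 'Re u)^-1.
have := grow n; apply/negP; rewrite -real_ltNge ?rpredM ?rpredB ?Creal_Re ?realn ?real1 //.
apply: (@lt_trans _ _ 1); first by rewrite ltrBlDr ltrDl.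
rewrite -ltr_pdivrMr // div1r; apply: (@le_lt_trans _ _ n%:R).
  by apply: le_trans (ltW Hn); rewrite real_ler_norm // realV gtr0_real.
by rewrite ltr_nat ltn_expl.
Qed.

(* With [N = 2 ^ m] such that ['Re (x ^+ N) <= 0], which exists because squaring
   doubles the argument, [('X^N - x ^+ N) * ('X^N - (x ^+ N)^* )] works. *)
Lemma nneg_multiplier (x : C) : ~~ (0 <= x) ->
  exists k : {poly C}, [/\ nnegp k, k != 0 & 'X - x%:P %| k].
Proof.
move=> x0; have xn0 : 0 < `|x|.
  by rewrite normr_gt0; apply: contraNneq x0 => ->.
have [||m Hm] := @unit_doubling (x / `|x|).
- by rewrite normrM normfV normr_id divff // gt_eqF.
- by apply: contra x0 => h; rewrite -(divfK (lt0r_neq0 xn0) x) mulr_ge0.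
set N := (2 ^ m)%N in Hm; set y := x ^+ N.
have y0 : 'Re y <= 0.
  move: Hm; rewrite exprMn exprVn ReMr ?rpredV ?rpredX ?normr_real //.
  by rewrite pmulr_lle0 // invr_gt0 exprn_gt0.
exists ('X^(N + N) - (2%:R * 'Re y) *: 'X^N + (y * y^*)%:P); split.
- move=> j; rewrite coefD coefB coefZ !coefXn coefC addr_ge0 //.
    rewrite subr_ge0 (@le_trans _ _ 0) ?ler0n //.
    by rewrite mulr_le0_ge0 ?ler0n // mulr_ge0_le0 ?ler0n.
  by case: ifP => // _; rewrite -normCK exprn_ge0.
- apply/eqP => /(congr1 (fun p : {poly C} => p`_(N + N))).
  have N0 : (0 < N)%N by rewrite expn_gt0.
  have e1 : (N + N == N)%N = false by rewrite -{3}[N]addn0 eqn_add2l eqn0Ngt N0.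
  have e2 : (N + N == 0)%N = false by rewrite addn_eq0 andbb eqn0Ngt N0.
  rewrite coefD coefB coefZ !coefXn coefC eqxx coef0 e1 e2 mulr0 subr0 addr0 => /eqP.
  by rewrite oner_eq0.
rewrite dvdp_XsubCl; apply/rootP.
rewrite !(hornerE, hornerXn) exprD -/y ReE; by field.
Qed.

Lemma dvdp_kills (p q : {poly C}) f : p %| q -> kills p f -> kills q f.
Proof. by move=> /dvdpP[r ->]; apply: killsM. Qed.

Definition rootsp rs : {poly C} := \prod_(x <- rs) ('X - x%:P).

Lemma rootsp_count x rs :
  rootsp rs = ('X - x%:P) ^+ count_mem x rs * rootsp [seq y <- rs | y != x].
Proof.
rewrite /rootsp (bigID (pred1 x)) /= -!(big_filter rs); congr (_ * _).
by rewrite big_filter (eq_bigr (fun=> 'X - x%:P)) ?big_const_seq ?iter_mulr_1 // => y /eqP ->.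
Qed.

Lemma nneg_multipliers rs : (forall x, x \in rs -> ~~ (0 <= x)) ->
  exists k : {poly C}, [/\ nnegp k, k != 0 & rootsp rs %| k].
Proof.
elim: rs => [|x rs IH] h.
  by exists 1; split; rewrite ?oner_eq0 // /rootsp ?big_nil // => j; rewrite coefC; case: ifP.
have [|k [k0 kn kd]] := IH; first by move=> y yr; apply: h; rewrite inE yr orbT.
have [l [l0 ln ld]] := nneg_multiplier (h x (mem_head _ _)).
exists (l * k); split; rewrite ?mulf_neq0 //; first exact: nnegpM.
by rewrite /rootsp big_cons dvdp_mul.
Qed.

Lemma affine_rec_bound (mu : C) (s M : C) (v w : nat -> C) : `|mu| < s ->
  (forall n, v n.+1 = mu * v n + w n) -> (forall n, `|w n| <= M * s ^+ n) ->
  exists M', forall n, `|v n| <= M' * s ^+ n.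
Proof.
move=> mus rec wM; have d0 : 0 < s - `|mu| by rewrite subr_gt0.
have M0 : 0 <= M by have := wM 0%N; rewrite expr0 mulr1; apply: le_trans.
have s0 : 0 < s by apply: le_lt_trans mus.
(* The quotient makes [|mu| * M' + M <= M' * s], the inductive step; [|v 0|] covers the start. *)
pose M' := `|v 0%N| + M / (s - `|mu|).
have eM : `|mu| * M' + M <= M' * s.
  rewrite -subr_ge0; have -> : M' * s - (`|mu| * M' + M) = `|v 0%N| * (s - `|mu|).
    by rewrite /M'; field; rewrite gt_eqF.
  by rewrite mulr_ge0 // ltW.
exists M'; elim=> [|n IH].
  by rewrite expr0 mulr1 lerDl divr_ge0 // ltW.
rewrite rec (le_trans (ler_normD _ _)) // normrM.
apply: le_trans (lerD (ler_wpM2l (normr_ge0 mu) IH) (wM n)) _.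
rewrite mulrA -mulrDl exprS mulrA ler_wpM2r // exprn_ge0 // ltW //.
Qed.

Lemma rootsp_bound rs (s : C) f : 0 < s -> (forall x, x \in rs -> `|x| < s) ->
  kills (rootsp rs) f -> exists M, forall n, `|f n| <= M * s ^+ n.
Proof.
move=> s0; elim: rs f => [|x rs IH] f h kf.
  exists 0 => n; have := kf n; rewrite /rootsp big_nil act1 => ->.
  by rewrite normr0 mul0r.
have [||M HM] := IH (act ('X - x%:P) f).
- by move=> y yr; apply: h; rewrite inE yr orbT.
- move=> n; rewrite -actM mulrC; have := kf n; by rewrite /rootsp big_cons.
apply: affine_rec_bound (h x (mem_head _ _)) _ HM => n.
by rewrite actXsubC subrKC.
Qed.

(* A root [x] of a minimal annihilator contributes the term [x ^+ n] to some
   combination of shifts of [f]. *)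
Lemma minimal_root_bound rs x (s M : C) f : 0 < s -> x \in rs ->
  kills (rootsp rs) f -> ~ kills (rootsp (rem x rs)) f ->
  (forall n, `|f n| <= M * s ^+ n) -> `|x| <= s.
Proof.
move=> s0 xrs kf nk fM; set v := act (rootsp (rem x rs)) f.
have rec n : v n.+1 = x * v n.
  have := kf n; rewrite /rootsp (perm_big _ (perm_to_rem xrs)) big_cons actM actXsubC.
  by move/eqP; rewrite subr_eq0 => /eqP.
have vE n : v n = x ^+ n * v 0%N.
  by elim: n => [|n IH]; rewrite ?mul1r // rec IH exprS mulrA.
have v0 : v 0%N != 0.
  by apply/eqP => e; apply: nk => n; rewrite -/(v n) vE e mulr0.
have [M' HM'] : exists M', forall n, `|v n| <= M' * s ^+ n.
  exists (\sum_(k < size (rootsp (rem x rs))) `|(rootsp (rem x rs))`_k| * (M * s ^+ k)) => n.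
  rewrite (le_trans (ler_norm_sum _ _ _)) // mulr_suml ler_sum // => k _.
  by rewrite normrM -!mulrA ler_wpM2l // (le_trans (fM _)) // addnC exprD.
have nv0 : 0 < `|v 0%N| by rewrite normr_gt0.
rewrite real_leNgt ?normr_real ?gtr0_real //; apply/negP => lt.
have M'0 : 0 <= M' by have := HM' 0%N; rewrite expr0 mulr1; apply: le_trans.
have [||n] := @expr_unbounded C arch (`|x| / s) (M' / `|v 0%N|).
- by rewrite ltr_pdivlMr // mul1r.
- by rewrite ger0_real // divr_ge0.
rewrite expr_div_n ltr_pdivrMr // mulrAC ltr_pdivlMr ?exprn_gt0 //.
by rewrite -normrX -normrM -vE; apply/negP; rewrite -real_leNgt ?HM' ?normr_real // rpredM ?rpredX ?(gtr0_real s0) // ger0_real.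
Qed.

Lemma nneg_list_max rs : (forall x, x \in rs -> 0 <= x) -> rs != [::] ->
  exists2 s, s \in rs & forall x, x \in rs -> x <= s.
Proof.
elim: rs => // x rs IH h _; have x0 := h x (mem_head _ _).
have [e|ne] := eqVneq rs [::].
  by exists x; rewrite ?mem_head // e => y; rewrite inE => /eqP ->.
have [|s srs smax] := IH _ ne; first by move=> y yr; apply: h; rewrite inE yr orbT.
have s0 : 0 <= s by apply: h; rewrite inE srs orbT.
have [le|le] := real_leP (ger0_real x0) (ger0_real s0).
  by exists s => [|y]; rewrite inE ?srs ?orbT // => /predU1P[-> //|/smax].
exists x => [|y]; rewrite ?mem_head // inE => /predU1P[-> //|/smax h'].
exact: le_trans h' (ltW le).
Qed.

(* An analogue of Pringsheim's theorem: after multiplying away the roots that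
   are not nonnegative reals by [nneg_multipliers], the remaining roots bound
   the growth of [a]. *)
Lemma nneg_dominant_root rs a : (forall n, 0 <= a n) -> rs != [::] ->
  kills (rootsp rs) a -> (forall x, x \in rs -> ~ kills (rootsp (rem x rs)) a) ->
  exists s, [/\ s \in rs, 0 <= s & forall x, x \in rs -> `|x| <= s].
Proof.
move=> a0 rs0 ka min; set P := [seq x <- rs | 0 <= x].
have [|k [k0 kn kd]] := @nneg_multipliers [seq x <- rs | ~~ (0 <= x)].
  by move=> x; rewrite mem_filter => /andP[].
have kP : kills (rootsp P) (act k a).
  move=> n; rewrite -actM; move: n; apply: dvdp_kills ka.
  rewrite /rootsp (bigID (fun x => 0 <= x)) /= -!(big_filter rs) dvdp_mul2l //.
  by apply/monic_neq0/monic_prod_XsubC.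
(* Strictness is what [rootsp_bound] needs when roots are multiple; a midpoint removes it at the
   end. *)
have bnd (s : C) : 0 < s -> (forall x, x \in P -> x < s) ->
    forall x, x \in rs -> `|x| <= s.
  move=> s0 Ps x xrs.
  have [|M HM] := rootsp_bound s0 _ kP.
    move=> y yP; rewrite ger0_norm ?Ps //; by move: yP; rewrite mem_filter => /andP[].
  set D := (size k).-1; have lc0 : 0 < k`_D by rewrite lt_neqAle k0 andbT eq_sym lead_coef_eq0.
  have M0 : 0 <= M by have := HM 0%N; rewrite expr0 mulr1; apply: le_trans.
  (* Every term of [act k a n] is nonnegative, so the leading one alone is at most the whole sum. *)
  have aD n : a (n + D)%N <= M / k`_D * s ^+ n.
    rewrite mulrAC ler_pdivlMr // mulrC; apply: le_trans (HM n).
    have hs : (D < size k)%N by rewrite /D prednK // lt0n size_poly_eq0.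
    rewrite ger0_norm; last by apply: sumr_ge0 => j _; rewrite mulr_ge0.
    by rewrite /act (bigD1 (Ordinal hs)) //= lerDl sumr_ge0 // => j _; rewrite mulr_ge0.
  apply: (@minimal_root_bound rs x s (\sum_(j < D) a j / s ^+ j + M / k`_D / s ^+ D) a) => //.
    exact: min.
  move=> n; rewrite ger0_norm // mulrDl; have [le|lt] := leqP D n.
    have -> : M / k`_D / s ^+ D * s ^+ n = M / k`_D * s ^+ (n - D).
      by rewrite -{1}(subnK le) exprD [s ^+ (n - D) * _]mulrC mulrA divfK // expf_neq0 // gt_eqF.
    apply: ler_wpDl; last by rewrite -{1}(subnK le) aD.
    rewrite mulr_ge0 ?exprn_ge0 ?(ltW s0) //; apply: sumr_ge0 => j _.
    by rewrite divr_ge0 ?exprn_ge0 // ltW.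
  apply: ler_wpDr; first by rewrite !mulr_ge0 ?invr_ge0 ?exprn_ge0 ?(ltW s0) ?(ltW lc0).
  rewrite (bigD1 (Ordinal lt)) //= mulrDl divfK ?expf_neq0 ?gt_eqF // lerDl.
  by rewrite mulr_ge0 ?exprn_ge0 ?(ltW s0) // sumr_ge0 // => j _; rewrite divr_ge0 ?exprn_ge0 // ltW.
(* If no root were nonnegative, [bnd] would hold for every positive [s], even for half the modulus
   of a nonzero root; a root 0 would itself lie in [P]. *)
have P0 : P != [::].
  have [x xrs] : exists x, x \in rs by case: rs rs0 {P kP kd ka min bnd} => // x rs _; exists x; rewrite mem_head.
  apply/negP => /eqP e; have [x0|x0] := eqVneq x 0.
    by have : x \in P; [rewrite mem_filter x0 lexx -x0 | rewrite e].
  have nx0 : 0 < `|x| by rewrite normr_gt0.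
  have : `|x| <= `|x| / 2%:R.
    by apply: bnd xrs; [rewrite divr_gt0 ?ltr0n | rewrite e].
  by rewrite ler_pdivlMr ?ltr0n // ger_pMr // (ler_nat _ 2 1).
have [|s sP smax] := @nneg_list_max P _ P0.
  by move=> x; rewrite mem_filter => /andP[].
have [s0 srs] : 0 <= s /\ s \in rs by move: sP; rewrite mem_filter => /andP[].
exists s; split=> // x xrs; rewrite real_leNgt ?normr_real ?ger0_real //.
apply/negP => lt; set t := (s + `|x|) / 2%:R.
have [st tx] := midf_lt lt.
have t0 : 0 < t by apply: le_lt_trans st.
have : `|x| <= t by apply: bnd xrs => // y /smax ys; apply: le_lt_trans st.
by move=> h; have := lt_le_trans tx h; rewrite ltxx.
Qed.

End Dominance.

(** * Asymptotics of recurrences with nonnegative differences *)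

Lemma map_rem_inj (T1 T2 : eqType) (f : T1 -> T2) x s : injective f ->
  [seq f y | y <- rem x s] = rem (f x) [seq f y | y <- s].
Proof.
move=> fI; elim: s => //= y s IH; rewrite (inj_eq fI).
by case: eqP => //= _; rewrite IH.
Qed.

Section Asymptotics.
Variable C : numClosedFieldType.
Hypothesis arch : forall x : C, exists n : nat, `|x| < n%:R.

Implicit Types (f a : nat -> C) (rs : seq C).

Lemma minimal_roots rs0 f : kills (rootsp rs0) f -> exists rs rest,
  [/\ perm_eq rs0 (rs ++ rest), kills (rootsp rs) f &
      forall x, x \in rs -> ~ kills (rootsp (rem x rs)) f].
Proof.
have [n] := ubnP (size rs0); elim: n rs0 => // n IH rs0 lt_n kf.
have [[x [xr kx]]|no] := classic (exists x, x \in rs0 /\ kills (rootsp (rem x rs0)) f).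
  have [|rs [rest [pe k m]]] := IH _ _ kx.
    by rewrite size_rem //; case: (rs0) xr lt_n.
  exists rs, (x :: rest); split=> //.
  rewrite (perm_trans (perm_to_rem xr)) // -cat1s perm_sym perm_catC cat1s /=.
  by rewrite perm_cons perm_catC perm_sym.
exists rs0, [::]; split; rewrite ?cats0 // => x xr k; apply: no; by exists x.
Qed.

Lemma act_sum I (r : seq I) (F : I -> {poly C}) f n :
  act (\sum_(i <- r) F i) f n = \sum_(i <- r) act (F i) f n.
Proof.
apply: (big_morph (fun p => act p f n)) => [p q|]; first exact: actD.
by rewrite -polyC0 actC mul0r.
Qed.

(** The next difference is one more factor ['X - 1], so the shift on [fwd_diff f] corresponds to
    ['X - 1] on [f]: all roots move by -1. *)
Lemma act_fwd_diff p f n :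
  act p (fwd_diff f) n = act (('X - 1%:P) ^+ n * (p \Po ('X - 1%:P))) f 0.
Proof.
rewrite comp_polyE big_distrr /= act_sum; apply: eq_bigr => i _.
by rewrite -scalerAr actZ -exprD.
Qed.

Lemma fwd_diff_eq0 f : (forall n, fwd_diff f n = 0) -> forall n, f n = 0.
Proof.
move=> f0 n; have -> : f n = act 'X^n f 0.
  elim: n f {f0} => [|n IH] f; first by rewrite expr0 act1.
  rewrite exprS actXM -[1%N]addn0 -act_shift -IH //.
(* Newton's formula: expand [((X - 1) + 1) ^ n] in powers of [X - 1]. *)
have -> : 'X^n = (('X^n \Po ('X + 1%:P)) \Po ('X - 1%:P)) :> {poly C}.
  by rewrite -comp_polyA comp_polyD comp_polyX comp_polyC subrK comp_polyXr.
rewrite -[_ \Po _]mul1r -(expr0 ('X - 1%:P)) -act_fwd_diff /act big1 // => k _.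
by rewrite f0 mulr0.
Qed.

Lemma rootsp_comp rs : rootsp [seq x - 1 | x <- rs] \Po ('X - 1%:P) = rootsp rs.
Proof.
rewrite /rootsp big_map rmorph_prod; apply: eq_bigr => x _.
by rewrite /= comp_polyB comp_polyX comp_polyC -addrA -opprD -polyCD subrKC.
Qed.

Lemma kills_fwd_diff rs f :
  kills (rootsp [seq x - 1 | x <- rs]) (fwd_diff f) <-> kills (rootsp rs) f.
Proof.
split=> kf n.
  apply: fwd_diff_eq0 => {}n; rewrite /fwd_diff -actM -rootsp_comp -act_fwd_diff.
  exact: kf.
by rewrite act_fwd_diff rootsp_comp; apply: killsM.
Qed.

(* Shifting by [1] turns the disk bound of [nneg_dominant_root] into a strict
   one: the disk of radius [lam - 1] around [1] touches the circle of radius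
   [lam] only at [lam]. *)
Lemma strictly_dominant_root rs f : (forall n, 0 <= fwd_diff f n) -> rs != [::] ->
  kills (rootsp rs) f -> (forall x, x \in rs -> ~ kills (rootsp (rem x rs)) f) ->
  exists lam, [/\ lam \in rs, 1 <= lam & forall x, x \in rs -> x != lam -> `|x| < lam].
Proof.
move=> f0 rs0 kf min; have inj : injective (fun x : C => x - 1) by apply: addIr.
have [||x|s [srs s0 smax]] := @nneg_dominant_root _ arch [seq x - 1 | x <- rs] _ f0.
- by case: (rs) rs0.
- exact/kills_fwd_diff.
- move=> /mapP[y yr ->] k; apply: (min y yr); apply/kills_fwd_diff.
  by rewrite map_rem_inj.
have [lam lrs es] := mapP srs; have l1 : 1 <= lam by rewrite -subr_ge0 -es.
exists lam; split=> // x xr nx.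
have bx : `|x - 1| <= lam - 1 by rewrite -es smax // (map_f (fun x => x - 1)).
have tri : `|x| <= `|x - 1| + 1 by rewrite -{1}[x](subrK 1) (le_trans (ler_normD _ _)) // normr1.
have le : `|x - 1| + 1 <= lam by rewrite -lerBrDr.
rewrite lt_neqAle (le_trans tri le) andbT; apply: contra nx => /eqP e.
(* A root on the circle turns the triangle inequality for [(x - 1) + 1] into an equality, so [x - 1]
   is a nonnegative real, hence [lam - 1]. *)
have e1 : `|(x - 1) + 1| = `|x - 1| + `|1 : C|.
  by rewrite subrK normr1; apply/eqP; rewrite eq_le tri e.
have e2 : `|x - 1| = lam - 1.
  by apply/eqP; rewrite eq_le bx lerBlDr -e.
have [t _ [h1 h2]] := normCDeq e1.
move: h2; rewrite normr1 mul1r => t1; move: h1; rewrite -t1 mulr1 e2 => /eqP.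
by rewrite (inj_eq inj).
Qed.

(** After division by [lam ^+ n], inverting ['X - mu] becomes an affine recurrence contracting by
    [mu / lam]; its fixed point produces the factor [1 / (lam - mu)]. *)
Lemma tends_root_strip (lam mu c : C) f : 0 < lam -> `|mu| < lam ->
  tends (fun n => act ('X - mu%:P) f n / lam ^+ n) c ->
  tends (fun n => f n / lam ^+ n) (c / (lam - mu)).
Proof.
move=> l0 ml hc; have ln0 : lam != 0 by rewrite gt_eqF.
have lm0 : lam - mu != 0.
  rewrite subr_eq0; apply: contraL ml => /eqP <-.
  by rewrite (gtr0_norm l0) ltxx.
have -> : c / (lam - mu) = (c * lam^-1) / (1 - mu / lam) by field; rewrite ln0.
apply: (@tends_affine_rec _ arch (mu / lam) _ (fun n => act ('X - mu%:P) f n / lam ^+ n * lam^-1)).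
- by rewrite normf_div (gtr0_norm l0) ltr_pdivrMr // mul1r.
- by move=> n; rewrite actXsubC exprS; field; rewrite ln0 expf_neq0.
exact: tendsM hc (tends_cst _).
Qed.

Lemma tends_roots_strip (lam c : C) rs f : 0 < lam ->
  (forall x, x \in rs -> `|x| < lam) ->
  tends (fun n => act (rootsp rs) f n / lam ^+ n) c ->
  tends (fun n => f n / lam ^+ n) (c / (rootsp rs).[lam]).
Proof.
move=> l0; elim: rs c f => [|x rs IH] c f h.
  rewrite /rootsp big_nil hornerC divr1; apply: tends_ext => n; by rewrite act1.
rewrite /rootsp big_cons -/(rootsp rs) hornerM hornerXsubC => hc.
rewrite invfM mulrA mulrAC; apply: tends_root_strip => //; first exact: h (mem_head _ _).
apply: IH => [y yr|]; first by apply: h; rewrite inE yr orbT.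
by apply: tends_ext hc => n; rewrite -actM [rootsp rs * _]mulrC.
Qed.

(** With [mu = lam] nothing contracts: the normalized sequence is a plain sum, and summation raises
    the binomial index by one. *)
Lemma tends_double_root_strip (lam c : C) f d : 0 < lam ->
  tends (fun n => act ('X - lam%:P) f n / ('C(n, d)%:R * lam ^+ n)) c ->
  tends (fun n => f n / ('C(n, d.+1)%:R * lam ^+ n)) (c / lam).
Proof.
move=> l0 hc; have ln0 : lam != 0 by rewrite gt_eqF.
have := @tends_sum_bin _ arch (fun n => f n / lam ^+ n)
  (fun n => act ('X - lam%:P) f n / lam ^+ n * lam^-1) d (c / lam) _ _.
move=> H; apply: tends_ext (H _ _) => [n|n|].
- by rewrite invfM mulrA mulrAC.
- by rewrite actXsubC exprS; field; rewrite ln0 expf_neq0.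
by apply: tends_ext (tendsM hc (tends_cst lam^-1)) => n; rewrite invfM; ring.
Qed.

Lemma tends_power_strip (lam c : C) f d : 0 < lam ->
  tends (fun n => act (('X - lam%:P) ^+ d) f n / lam ^+ n) c ->
  tends (fun n => f n / ('C(n, d)%:R * lam ^+ n)) (c / lam ^+ d).
Proof.
move=> l0; elim: d c f => [|d IH] c f hc.
  by rewrite divr1; apply: tends_ext hc => n; rewrite act1 bin0 mul1r.
rewrite exprSr invfM mulrA.
apply: tends_double_root_strip => //; apply: IH.
by apply: tends_ext hc => n; rewrite -actM exprSr.
Qed.

(** The constant is expressed by the given [rs0], not by a minimal annihilator: in the application
    [rs0] lists the roots of a rational polynomial, which places the numerator of [c] in Q(lam). *)
Theorem linear_recurrence_asymptotics rs0 f : kills (rootsp rs0) f ->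
  (exists n, f n != 0) -> (forall n, 0 <= fwd_diff f n) ->
  exists lam d c, [/\ lam \in rs0, 1 <= lam, (d < count_mem lam rs0)%N, c != 0 &
    tends (fun n => f n / ('C(n, d)%:R * lam ^+ n)) c /\
    let chi1 := rootsp [seq x <- rs0 | x != lam] in
    c = act (('X - lam%:P) ^+ d * chi1) f 0 / (chi1.[lam] * lam ^+ d)].
Proof.
move=> kf0 [n0 fn0] f0; have [rs [rest [pe kf min]]] := minimal_roots kf0.
have rs0' : rs != [::].
  apply/eqP => e; case/eqP: fn0; have := kf n0; by rewrite e /rootsp big_nil act1.
have [lam [lrs l1 ldom]] := strictly_dominant_root f0 rs0' kf min.
have l0 : 0 < lam by apply: lt_le_trans l1.
set d := (count_mem lam rs).-1.
have dS : d.+1 = count_mem lam rs by rewrite /d prednK // -has_count has_pred1.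
set A := rootsp [seq x <- rs | x != lam].
(* All of the minimal annihilator but one factor ['X - lam]: the result is geometric, and nonzero by
   minimality. *)
set g := act (('X - lam%:P) ^+ d * A) f.
have grec n : g n.+1 = lam * g n.
  have := kf n; rewrite (rootsp_count lam) -dS exprS -mulrA actM actXsubC.
  by move/eqP; rewrite subr_eq0 => /eqP.
have gE n : g n = g 0%N * lam ^+ n.
  by elim: n => [|n IH]; rewrite ?mulr1 // grec IH exprS mulrCA.
have g0 : g 0%N != 0.
  apply/eqP => e; apply: (min _ lrs) => n.
  have -> : rootsp (rem lam rs) = ('X - lam%:P) ^+ d * A.
    apply: (mulfI (negbT (polyXsubC_eq0 lam))); rewrite mulrA -exprS dS -rootsp_count.
    by rewrite /rootsp [in RHS](perm_big _ (perm_to_rem lrs)) big_cons.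
  by rewrite -/g gE e mul0r.
have Alam s : (rootsp [seq x <- s | x != lam]).[lam] != 0.
  by rewrite -/(root _ _) root_prod_XsubC mem_filter eqxx.
set c := g 0%N / A.[lam] / lam ^+ d.
exists lam, d, c; split=> //.
- by rewrite (perm_mem pe) mem_cat lrs.
- by rewrite (permP pe) count_cat -dS leq_addr.
- by rewrite !mulf_neq0 ?invr_eq0 ?Alam ?expf_neq0 // gt_eqF.
split.
  apply: tends_power_strip => //; apply: tends_roots_strip => //.
    by move=> x; rewrite mem_filter => /andP[nx /ldom]; apply.
  apply: tends_ext (tends_cst (g 0%N)) => n.
  by rewrite -actM [A * _]mulrC -/g (gE n) mulfK // expf_neq0 // gt_eqF.
rewrite /=; set B := rootsp [seq x <- rest | x != lam].
have -> : rootsp [seq x <- rs0 | x != lam] = A * B.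
  by rewrite {1}/rootsp big_filter (perm_big _ pe) big_cat /= -!(big_filter _ (fun x => x != lam)).
have -> : act (('X - lam%:P) ^+ d * (A * B)) f 0 = B.[lam] * g 0%N.
  have -> : ('X - lam%:P) ^+ d * (A * B) = B * (('X - lam%:P) ^+ d * A) by ring.
  by rewrite actM -/g (eq_act _ gE) act_geom expr0 mulr1.
rewrite hornerM.
have [hA hB] : A.[lam] != 0 /\ B.[lam] != 0 by split; apply: Alam.
by rewrite /c; field; rewrite ?hA ?hB ?expf_neq0 ?gt_eqF.
Qed.
End Asymptotics.

(** * Ratios of comparable recurrent sequences *)

Section Ratio.
Variable C : numClosedFieldType.
Hypothesis arch : forall x : C, exists n : nat, `|x| < n%:R.

Lemma tends_bin_ratio d e : (d < e)%N ->
  tends (fun n => 'C(n, d)%:R / 'C(n, e)%:R : C) 0.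
Proof.
elim: d e => [|d IH] [|e] // lt.
  by apply: tends_ext (tends_binV arch e) => n; rewrite bin0 mul1r.
apply: (null_sum_bin arch (v := fun n => 'C(n, d)%:R)) (IH e lt) => n.
by rewrite binS natrD.
Qed.

(** If the order of [f1] were larger, [f2] divided by it would tend to 0, and so would [f1], against
    [c1 != 0]. *)
Lemma growth_order_le (f1 f2 : nat -> C) (l1 l2 c1 c2 : C) (K d1 d2 : nat) :
  0 < l1 -> 0 < l2 -> c1 != 0 -> 
  tends (fun n => f1 n / ('C(n, d1)%:R * l1 ^+ n)) c1 ->
  tends (fun n => f2 n / ('C(n, d2)%:R * l2 ^+ n)) c2 ->
  (forall n, `|f1 n| <= K%:R * `|f2 n|) ->
  ~ (l2 < l1 \/ l2 = l1 /\ (d2 < d1)%N).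
Proof.
move=> l10 l20 c10 h1 h2 le12 lt.
have r0 : tends (fun n => 'C(n, d2)%:R * l2 ^+ n / ('C(n, d1)%:R * l1 ^+ n)) 0.
  case: lt => [lt|[-> lt]]; last first.
    apply: tends_ext (tends_bin_ratio lt) => n.
    by rewrite invfM mulrACA divff ?mulr1 // expf_neq0 // gt_eqF.
  have q1 : `|l2 / l1| < 1.
    by rewrite ger0_norm ?divr_ge0 ?ltW // ltr_pdivrMr // mul1r.
  have H : tends (fun n => 'C(n, d2)%:R * (l2 / l1) ^+ n * ('C(n, d1)%:R)^-1) 0.
    apply: (@null_mul _ _ (fun n => ('C(n, d1)%:R)^-1) 1 (tends_bin_geom arch d2 q1)) => n.
    case: (posnP 'C(n, d1)) => [-> | C0]; first by rewrite invr0 normr0.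
    by rewrite normfV normr_nat invf_le1 ?ltr0n // ler1n.
  by apply: tends_ext H => n; rewrite expr_div_n invfM; ring.
have := @null_mul _ _ (fun n => f2 n / ('C(n, d2)%:R * l2 ^+ n)).
have [M M0 HM] := tends_bounded h2; move=> /(_ _ M r0 HM) h3.
have h4 := tendsM (tends_cst K%:R) h3; rewrite mulr0 in h4.
case/eqP: c10; apply: tends_uniq (tends_shift d2 h1) _.
apply: tends_null_dom (tends_shift d2 h4) => n.
set m := (n + d2)%N.
have n2 : 'C(m, d2)%:R * l2 ^+ m != 0 :> C.
  by rewrite mulf_neq0 ?expf_neq0 ?(gt_eqF l20) // pnatr_eq0 -lt0n bin_gt0 leq_addl.
have -> : K%:R * ('C(m, d2)%:R * l2 ^+ m / ('C(m, d1)%:R * l1 ^+ m) * (f2 m / ('C(m, d2)%:R * l2 ^+ m))) = K%:R * f2 m / ('C(m, d1)%:R * l1 ^+ m).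
  move: n2; set B2 := _ * l2 ^+ m; set B1 := _ * l1 ^+ m => n2.
  have -> : K%:R * (B2 / B1 * (f2 m / B2)) = K%:R * f2 m / B1 * (B2 / B2) by ring.
  by rewrite divff // mulr1.
by rewrite !normf_div ler_wpM2r ?invr_ge0 // (le_trans (le12 m)) // normrM normr_nat.
Qed.

(** Membership in Q[l]. Sums and products suffice below, because the final quotient is kept as a
    numerator and a denominator. *)
Definition in_field (l x : C) := exists P : {poly rat}, x = (map_poly ratr P).[l].

Lemma in_fieldD l x y : in_field l x -> in_field l y -> in_field l (x + y).
Proof. by move=> [P ->] [Q ->]; exists (P + Q); rewrite rmorphD hornerD. Qed.

Lemma in_fieldM l x y : in_field l x -> in_field l y -> in_field l (x * y).
Proof. by move=> [P ->] [Q ->]; exists (P * Q); rewrite rmorphM hornerM. Qed.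

Lemma in_field_rat l q : in_field l (ratr q).
Proof. by exists q%:P; rewrite map_polyC hornerC. Qed.

Lemma in_field_gen l : in_field l l.
Proof. by exists 'X; rewrite map_polyX hornerX. Qed.

Lemma in_field0 l : in_field l 0.
Proof. by exists 0; rewrite rmorph0 horner0. Qed.

(** Synthetic division: each coefficient of [q] is the next coefficient of the product plus [l]
    times the next coefficient of [q], so they are found from the top down. *)
Lemma in_field_strip l (q : {poly C}) :
  (forall k, in_field l (('X - l%:P) * q)`_k) -> forall k, in_field l q`_k.
Proof.
move=> h k; have [n] := ubnP (size q - k); elim: n k => // n IH k lt.
have [le|gt] := leqP (size q) k; first by rewrite nth_default //; apply: in_field0.
have -> : q`_k = (('X - l%:P) * q)`_k.+1 + l * q`_k.+1.
  by rewrite mulrBl coefB coefXM coefCM /= subrK.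
apply: in_fieldD => //; apply: in_fieldM (in_field_gen l) _; apply: IH.
by rewrite -ltnS (leq_trans _ lt) // ltnS subnS prednK ?leqnn // subn_gt0.
Qed.

Lemma in_field_strips l n (q : {poly C}) :
  (forall k, in_field l (('X - l%:P) ^+ n * q)`_k) -> forall k, in_field l q`_k.
Proof.
elim: n q => [|n IH] q; first by rewrite mul1r.
by rewrite exprSr -mulrA => /IH; apply: in_field_strip.
Qed.

Lemma in_field_act l (p : {poly C}) (T : nat -> nat) :
  (forall k, in_field l p`_k) -> in_field l (act p (fun n => (T n)%:R) 0).
Proof.
move=> h; rewrite /act; elim/big_ind: _ => [|x y|k _]; first exact: in_field0.
  exact: in_fieldD.
by apply: in_fieldM => //; exists (T (0 + k)%N)%:R; rewrite rmorph_nat -polyC1 -polyC_natr hornerC.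
Qed.

(** Domination in both directions forces equal roots and equal binomial degrees. In [cT / cS] the
    denominators then cancel, and only values of [psi] on the two sequences remain. *)
Theorem recurrence_ratio (chi : {poly rat}) (S T : nat -> nat) K :
  chi != 0 ->
  kills (map_poly ratr chi) (fun n => (S n)%:R : C) ->
  kills (map_poly ratr chi) (fun n => (T n)%:R : C) ->
  (forall n, 0 <= fwd_diff (fun n => (S n)%:R : C) n) ->
  (forall n, 0 <= fwd_diff (fun n => (T n)%:R : C) n) ->
  (forall n, 0 < S n)%N -> (forall n, T n <= K * S n)%N -> (forall n, S n <= K * T n)%N ->
  exists xi l : C, [/\ tends (fun n => (T n)%:R / (S n)%:R) xi,
    root (map_poly ratr chi) l, 1 <= l &
    exists P Q : {poly rat}, (map_poly ratr Q).[l] != 0 /\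
      xi = (map_poly ratr P).[l] / (map_poly ratr Q).[l]].
Proof.
move=> chi0 kS kT DS DT S0 TS ST.
have T0 n : (0 < T n)%N by have := leq_trans (S0 n) (ST n); rewrite muln_gt0 => /andP[].
set X := map_poly ratr chi : {poly C} in kS kT *.
have X0 : X != 0 by rewrite map_poly_eq0.
have [rs0 eX] := closed_field_poly_normal X; rewrite -/(rootsp rs0) in eX.
have lc0 : lead_coef X != 0 by rewrite lead_coef_eq0.
have eR : rootsp rs0 = (lead_coef X)^-1 *: X by rewrite {2}eX scalerA mulVf // scale1r.
have kR f : kills X f -> kills (rootsp rs0) f.
  by move=> k n; rewrite eR actZ k mulr0.
have nz (U : nat -> nat) : (forall n, 0 < U n)%N -> exists n, (U n)%:R != 0 :> C.
  by move=> U0; exists 0%N; rewrite pnatr_eq0 -lt0n.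
have [lS [dS [cS [lSr lS1 ltS cS0 [tS ES]]]]] := linear_recurrence_asymptotics arch (kR _ kS) (nz _ S0) DS.
have [lT [dT [cT [lTr lT1 ltT cT0 [tT ET]]]]] := linear_recurrence_asymptotics arch (kR _ kT) (nz _ T0) DT.
have lS0 : 0 < lS by apply: lt_le_trans lS1.
have lT0 : 0 < lT by apply: lt_le_trans lT1.
have cmp (U V : nat -> nat) : (forall n, U n <= K * V n)%N ->
    forall n, `|(U n)%:R : C| <= K%:R * `|(V n)%:R|.
  by move=> UV n; rewrite !normr_nat -natrM ler_nat.
have o1 := growth_order_le lT0 lS0 cT0 tT tS (cmp _ _ TS).
have o2 := growth_order_le lS0 lT0 cS0 tS tT (cmp _ _ ST).
have el : lS = lT.
  have [lt|lt|//] := real_ltgtP (gtr0_real lS0) (gtr0_real lT0).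
    by case: o1; left.
  by case: o2; left.
subst lT; have ed : dS = dT.
  by have [lt|lt|//] := ltngtP dS dT; [case: o1 | case: o2]; right.
subst dT; set l := lS in lSr lS1 ltS ES ET lS0 tS tT *; set d := dS in ltS ES ET tS tT *.
set chi1 := rootsp [seq x <- rs0 | x != l] in ES ET.
set psi := ('X - l%:P) ^+ d * chi1 in ES ET.
have chi10 : chi1.[l] * l ^+ d != 0.
  rewrite mulf_neq0 ?expf_neq0 ?(gt_eqF lS0) //.
  by rewrite -/(root _ _) root_prod_XsubC mem_filter eqxx.
(* A power of ['X - l] times [psi] is a rational multiple of [chi]. *)
have psiK k : in_field l psi`_k.
  apply: (@in_field_strips l (count_mem l rs0 - d)) => {}k.
  rewrite mulrA -exprD subnK ?(ltnW ltS) //.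
  rewrite -rootsp_count eR coefZ; apply: in_fieldM.
    by rewrite lead_coef_map -fmorphV; apply: in_field_rat.
  by rewrite coef_map; apply: in_field_rat.
have [P EP] := in_field_act T psiK; have [Q EQ] := in_field_act S psiK.
exists (cT / cS), l; split=> //.
- apply: (tends_unshift (m := d)); have := tends_shift d (tendsM tT (tendsV tS cS0)).
  apply: tends_ext => n; set m := (n + d)%N.
  have : 'C(m, d)%:R * l ^+ m != 0 :> C.
    by rewrite mulf_neq0 ?expf_neq0 ?(gt_eqF lS0) // pnatr_eq0 -lt0n bin_gt0 leq_addl.
  set B := _ * l ^+ m => B0; field; rewrite B0 pnatr_eq0 -lt0n S0 //.
- by rewrite -/(root _ _) eX rootZ // root_prod_XsubC.
exists P, Q; rewrite -EP -EQ.
have EQ0 : act psi (fun n => (S n)%:R) 0 != 0.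
  by apply: contraNneq cS0 => e; rewrite ES e mul0r.
split=> //; rewrite ES ET; move: chi10; set u := chi1.[l] * _ => u0.
by field; rewrite EQ0 u0.
Qed.
End Ratio.

(** * Algebraicity of limits of ratios *)

Lemma rat_lin_dep D (v : nat -> 'rV[rat]_D) :
  exists q : {poly rat}, [/\ q != 0, (size q <= D.+1)%N &
    \sum_(k < D.+1) q`_k *: v k = 0].
Proof.
pose A := \matrix_(k < D.+1) v k.
have K0 : kermx A != 0.
  by rewrite -mxrank_eq0 mxrank_ker -lt0n subn_gt0 ltnS rank_leq_col.
have [u /sub_kermxP uA u0] := rowV0Pn K0.
exists (rVpoly u); split.
- apply: contra u0 => /eqP e; by rewrite -[u]rVpolyK e linear0.
- exact: size_poly.
rewrite -[RHS]uA mulmx_sum_row; apply: eq_bigr => k _.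
by rewrite coef_rVpoly_ord rowK.
Qed.

Section Degree.
Variable F : numFieldType.

(** The [D + 1] products [P ^+ k * Q ^+ (D - k)] are dependent modulo [chi]; evaluate at [l] and
    divide by the [D]-th power of the value of [Q]. Homogenizing avoids inverting [Q] modulo a
    possibly reducible [chi]. *)
Lemma algebraic_of_rational_function (chi P Q : {poly rat}) (l : F) : chi != 0 ->
  root (map_poly ratr chi) l -> (map_poly ratr Q).[l] != 0 ->
  exists q : {poly rat}, [/\ q != 0, (size q <= size chi)%N &
    root (map_poly ratr q) ((map_poly ratr P).[l] / (map_poly ratr Q).[l])].
Proof.
move=> chi0 /rootP rl Q0; set D := (size chi).-1.
have DS : D.+1 = size chi by rewrite prednK // lt0n size_poly_eq0.
pose w k := P ^+ k * Q ^+ (D - k).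
have [q [q0 sq eq0]] := rat_lin_dep (fun k => poly_rV (w k %% chi) : 'rV_D).
exists q; split; rewrite -?DS //.
have : chi %| \sum_(k < D.+1) q`_k *: w k.
  rewrite /dvdp; apply/eqP.
  have := congr1 rVpoly eq0; rewrite linear0 linear_sum /= => {2}<-.
  rewrite (big_morph (fun p => p %% chi) (fun p q => modpD _ p q) (mod0p _)).
  apply: eq_bigr => k _; rewrite modpZl linearZ /= poly_rV_K //.
  by rewrite -ltnS [X in (_ < X)%N]DS ltn_modp.
move=> /dvdpP[r er]; have := congr1 (fun p => (map_poly (ratr : rat -> F) p).[l]) er.
rewrite /= rmorphM hornerM rl mulr0 rmorph_sum horner_sum => e.
apply/rootP; rewrite (@horner_coef_wide _ D.+1) ?size_map_poly //.
apply/(mulIf (expf_neq0 D Q0)); rewrite mul0r -[RHS]e mulr_suml.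
apply: eq_bigr => k _; rewrite coef_map /= map_polyZ hornerZ -mulrA; congr (_ * _).
rewrite /w rmorphM !rmorphXn hornerM !horner_exp expr_div_n.
have le : (k <= D)%N by rewrite -ltnS.
have {1}-> : (map_poly ratr Q).[l] ^+ D = (map_poly ratr Q).[l] ^+ k * (map_poly ratr Q).[l] ^+ (D - k).
  by rewrite -exprD subnKC.
by rewrite mulrA divfK // expf_neq0.
Qed.

End Degree.

Lemma complex_arch (x : R[i]) : exists n : nat, `|x| < n%:R.
Proof.
rewrite normc_def; set r := Num.sqrt _.
exists (Num.Def.archi_bound r); rewrite -(rmorph_nat (real_complex R)) ltcR.
by apply: archi_boundP; apply: sqrtr_ge0.
Qed.

Lemma recurrence_ratio_real (chi : {poly rat}) (S T : nat -> nat) K :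
  chi != 0 ->
  kills (map_poly ratr chi) (fun n => (S n)%:R : R[i]) ->
  kills (map_poly ratr chi) (fun n => (T n)%:R : R[i]) ->
  (forall n, 0 <= fwd_diff (fun n => (S n)%:R : R[i]) n) ->
  (forall n, 0 <= fwd_diff (fun n => (T n)%:R : R[i]) n) ->
  (forall n, 0 < S n)%N -> (forall n, T n <= K * S n)%N -> (forall n, S n <= K * T n)%N ->
  exists xi l : R, [/\
    Un_cv (fun n => Rdiv (INR (T n)) (INR (S n))) xi,
    root (map_poly ratr chi) l, 1 <= l &
    exists P Q : {poly rat}, (map_poly ratr Q).[l] != 0 /\
      xi = (map_poly ratr P).[l] / (map_poly ratr Q).[l]].
Proof.
move=> chi0 kS kT DS DT S0 TS ST.
have [xi [l [lim rl l1 [P [Q [Q0 exi]]]]]] :=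
  recurrence_ratio complex_arch chi0 kS kT DS DT S0 TS ST.
(* [1 <= l] in [R[i]] makes [l] real, so rational polynomials take real values there. *)
have horner_C (p : {poly rat}) : (map_poly ratr p).[l] = ((map_poly ratr p).[complex.Re l])%:C%C.
  have el : l = (complex.Re l)%:C%C by rewrite RRe_real // (ger0_real (le_trans ler01 l1)).
  rewrite {1}el -horner_map -map_poly_comp; congr (_.[_]).
  by apply: eq_map_poly => x /=; rewrite fmorph_rat.
have inj0 (p : {poly rat}) : ((map_poly ratr p).[l] == 0) = ((map_poly ratr p).[complex.Re l] == 0).
  by rewrite horner_C -(rmorph0 (real_complex R)) (inj_eq (@complexI R)).
exists (complex.Re xi), (complex.Re l); split.
- move=> eps /RltP eps0; have [|N HN] := lim (eps%:C%C).
    by rewrite -(rmorph0 (real_complex R)) ltcR.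
  exists N => n /ssrnat.leP /HN lt; rewrite /Rdist !RealsE; apply/RltP.
  rewrite -ltcR; apply: le_lt_trans lt; apply: le_trans (normc_ge_Re _).
  rewrite lecR raddfB /= -!(rmorph_nat (real_complex R)) -fmorphV -rmorphM /=.
  by [].
- by rewrite /root -inj0.
- by move: l1; rewrite lecE => /andP[].
exists P, Q; split; first by rewrite -inj0.
by rewrite exi !horner_C -fmorphV -rmorphM.
Qed.

Lemma Z_of_intE (z : int) : IZR (Z_of_int z) = z%:~R.
Proof.
case: z => n /=.
  by rewrite -INR_IZR_INZ INRE.
by rewrite opp_IZR -INR_IZR_INZ INRE addn1 RoppE NegzE mulrNz.
Qed.

Lemma algebraic_deg_le_root (x : R) (q : {poly rat}) d : q != 0 -> (size q <= d.+1)%N ->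
  root (map_poly ratr q) x -> algebraic_deg_le x d.
Proof.
move=> q0 sq /rootP rx; have [z [a a0 ez]] := rat_poly_scale q.
have [k kz] : exists k, z`_k != 0.
  exists (size z).-1; rewrite -lead_coefE lead_coef_eq0; apply: contra q0 => /eqP e.
  by rewrite ez e rmorph0 scaler0.
have coefq j : q`_j = a%:~R^-1 * (z`_j)%:~R by rewrite ez coefZ coef_map.
exists (fun k => Z_of_int z`_k); split.
  exists k; split; last first.
    by move=> e; case/eqP: kz; apply: (@intr_inj R); rewrite -Z_of_intE e.
  rewrite -ltnS (leq_trans _ sq) // ltnNge; apply: contra kz => le.
  have := coefq k; rewrite nth_default // => /esym/eqP.
  by rewrite mulf_eq0 invr_eq0 !intr_eq0 (negbTE a0).
rewrite R0E sum_f_R0E big_mkord -[RHS](mulr0 a%:~R) -[in RHS]rx.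
rewrite (@horner_coef_wide _ d.+1) ?size_map_poly // mulr_sumr.
apply: eq_bigr => j _; rewrite coef_map /= coefq rmorphM fmorphV /= !ratr_int -mulrA mulVKf ?intr_eq0 //.
by rewrite Z_of_intE RpowE.
Qed.

Lemma is_rational_ratr (q : rat) : is_rational (ratr q).
Proof.
exists (Z_of_int (numq q)), (Z_of_int (denq q)); split.
  move=> e; have := denq_neq0 q; rewrite -(intr_eq0 R) -Z_of_intE e.
  by rewrite -R0E eqxx.
by rewrite !Z_of_intE RdivE.
Qed.

Lemma algebraic_deg_le1 d : (0 < d)%N -> algebraic_deg_le 1 d.
Proof.
move=> d0; apply: (@algebraic_deg_le_root _ ('X - 1%:P)).
- by rewrite polyXsubC_eq0.
- by rewrite size_XsubC.
by rewrite rmorphB /= map_polyX map_polyC /= rmorph1 root_XsubC.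
Qed.

Lemma is_rational1 : is_rational 1.
Proof. by have := is_rational_ratr 1; rewrite rmorph1. Qed.

(** * Lengths of iterated images *)

Section Lengths.
Variables (Sigma : finType) (g : Sigma -> seq Sigma).

Definition len n s := size (morph_iter g n s).

Lemma morph_word_cat s t : morph_word g (s ++ t) = morph_word g s ++ morph_word g t.
Proof. by rewrite /morph_word map_cat flatten_cat. Qed.

Lemma morph_iter_cat n s t : morph_iter g n (s ++ t) = morph_iter g n s ++ morph_iter g n t.
Proof. by elim: n => //= n IH; rewrite /morph_iter /= -!/(morph_iter g n _) IH morph_word_cat. Qed.

Lemma len_cat n s t : len n (s ++ t) = (len n s + len n t)%N.
Proof. by rewrite /len morph_iter_cat size_cat. Qed.

Lemma len_nil n : len n [::] = 0%N.
Proof. by elim: n => //= n; rewrite /len /morph_iter iterSr. Qed.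

Lemma lenS n s : len n.+1 s = len n (morph_word g s).
Proof. by rewrite /len /morph_iter iterSr. Qed.

Lemma len_sum n s : len n s = (\sum_(c <- s) len n [:: c])%N.
Proof.
elim: s => [|c s IH]; first by rewrite big_nil len_nil.
by rewrite big_cons -cat1s len_cat IH.
Qed.

Lemma lenS_sum n c : len n.+1 [:: c] = (\sum_(d <- g c) len n [:: d])%N.
Proof. by rewrite lenS -len_sum /morph_word /= cats0. Qed.

Section Field.
Variable F : numFieldType.

Definition lenF s n : F := (len n s)%:R.

Lemma act_natsum (p : {poly F}) I (r : seq I) (f : I -> nat -> nat) n :
  act p (fun k => (\sum_(i <- r) f i k)%:R) n = \sum_(i <- r) act p (fun k => (f i k)%:R) n.
Proof.
rewrite /act exchange_big /=; apply: eq_bigr => k _.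
by rewrite natr_sum big_distrr.
Qed.

Lemma act_lenF_sum p s n : act p (lenF s) n = \sum_(c <- s) act p (lenF [:: c]) n.
Proof. by rewrite -act_natsum; apply: eq_act => k; rewrite /lenF len_sum. Qed.

Lemma act_lenF_step p c n :
  act p (lenF [:: c]) n.+1 = \sum_(d <- g c) act p (lenF [:: d]) n.
Proof.
rewrite -act_natsum; apply: eq_bigr => k _.
by rewrite /lenF addSn lenS_sum.
Qed.

Hypothesis trans_g : forall c d e, d \in g c -> e \in g d -> e \in g c.

(** Bounds how many nonrecurring letters a path of descendants of [c] can meet: by transitivity, all
    descendants already occur in [g c]. *)
Definition rank c := #|[set d | ((d == c) || (d \in g c)) && (d \notin g d)]|.

Lemma rank_le c d : d \in g c -> (rank d <= rank c)%N.
Proof.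
move=> dc; apply/subset_leq_card/subsetP => e; rewrite !inE => /andP[h ->].
case/orP: h => [/eqP -> | ed]; first by rewrite dc orbT.
by rewrite (trans_g dc ed) orbT.
Qed.

Lemma rank_lt c d : d \in g c -> c \notin g c -> (rank d < rank c)%N.
Proof.
move=> dc cc; apply/proper_card/properP; split.
  apply/subsetP => e; rewrite !inE => /andP[h ->].
  case/orP: h => [/eqP -> | ed]; first by rewrite dc orbT.
  by rewrite (trans_g dc ed) orbT.
exists c; rewrite !inE ?eqxx ?cc // andbT.
by apply/negP => /orP[/eqP e | cd]; [rewrite -e in dc; rewrite dc in cc | rewrite (trans_g dc cd) in cc].
Qed.

(* The forward difference of a letter [c] occurring in [g c] drops one
   occurrence of [c]; the other letters are expanded once more, which can only
   happen [rank c] times along a path. *)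
Lemma fwd_diff_len_ge0 n m c : (rank c <= m)%N ->
  0 <= act (('X - 1%:P) ^+ n) (lenF [:: c]) m.
Proof.
elim: n m c => [|n IHn] m c; first by rewrite expr0 act1 ler0n.
elim: m c => [|m IHm] c le; have [cc|cc] := boolP (c \in g c).
- rewrite exprS actM actXsubC mul1r act_lenF_step (perm_big _ (perm_to_rem cc)) big_cons addrAC subrr add0r.
  rewrite big_seq sumr_ge0 // => d dr; apply: IHn; apply: leq_trans le.
  by apply/rank_le/(mem_rem dr).
- move: le; rewrite leqn0 cards_eq0 => /eqP/setP/(_ c).
  by rewrite !inE eqxx cc.
- rewrite exprS actM actXsubC mul1r act_lenF_step (perm_big _ (perm_to_rem cc)) big_cons addrAC subrr add0r.
  rewrite big_seq sumr_ge0 // => d dr; apply: IHn; apply: leq_trans le.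
  by apply/rank_le/(mem_rem dr).
rewrite act_lenF_step big_seq sumr_ge0 // => d dr; apply: IHm.
by rewrite -ltnS (leq_trans _ le) // rank_lt.
Qed.

(* [f] is, up to a constant, [len n u + \sum_(k < n) len k y]. *)
Definition affine_len (f : nat -> nat) u y :=
  forall n, (f n.+1 + len n u = f n + len n.+1 u + len n y)%N.

Lemma affine_len_diff f u y : affine_len f u y -> forall n,
  act ('X - 1%:P) (fun n => (f n)%:R : F) n =
  act ('X - 1%:P) (lenF u) n + lenF y n.
Proof.
move=> fa n; rewrite !actXsubC !mul1r /lenF.
have := congr1 (fun n => n%:R : F) (fa n); rewrite !natrD => e.
by rewrite -[(f n.+1)%:R](addrK (len n u)%:R) e; ring.
Qed.

(** The shift by [#|Sigma|] is at least every rank, the delay that [fwd_diff_len_ge0] asks for. *)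
Lemma affine_len_fwd_diff f u y : affine_len f u y ->
  forall n, 0 <= fwd_diff (fun n => (f (#|Sigma| + n)%N)%:R : F) n.
Proof.
move=> fa n; rewrite /fwd_diff.
rewrite (act_shift _ (fun n => (f n)%:R)) addn0.
have r c : (rank c <= #|Sigma|)%N by apply: max_card.
case: n => [|n]; first by rewrite expr0 act1.
rewrite exprSr actM (eq_act _ (affine_len_diff fa)) act_add -actM -exprSr.
by rewrite addr_ge0 // act_lenF_sum sumr_ge0 // => c _; apply: fwd_diff_len_ge0.
Qed.

(** The sum over [y] costs the additional factor ['X - 1]. *)
Lemma affine_len_kills f u y chi : affine_len f u y ->
  (forall c, kills chi (lenF [:: c])) ->
  kills (chi * ('X - 1%:P)) (fun n => (f n)%:R : F).
Proof.
move=> fa kc n; rewrite actM (eq_act _ (affine_len_diff fa)) act_add -actM.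
have ks s k : act chi (lenF s) k = 0.
  by rewrite act_lenF_sum big1 // => c _; apply: kc.
by rewrite mulrC actM (eq_act _ (ks u)) ks actXsubC mulr0 subr0 addr0.
Qed.

End Field.

(** A dependency among the length vectors at times 0 to [#|Sigma|] persists at later times, since
    lengths at time [n + 1] are sums of lengths at time [n]. It replaces the characteristic
    polynomial of the incidence matrix. *)
Lemma len_recurrence : exists q : {poly rat}, [/\ q != 0, (size q <= #|Sigma|.+1)%N &
  forall (F : numFieldType) c, kills (map_poly ratr q) (@lenF F [:: c])].
Proof.
have [q [q0 sq eq]] := rat_lin_dep (fun k => \row_(j < #|Sigma|) @lenF rat [:: enum_val j] k).
exists q; split=> // F c n.
have kq : act q (@lenF rat [:: c]) n = 0.
  elim: n c => [|n IH] c; last by rewrite act_lenF_step big1.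
  have := congr1 (fun M : 'rV_ _ => M 0 (enum_rank c)) eq.
  rewrite summxE mxE => e; rewrite (act_wide _ _ sq) -[RHS]e; apply: eq_bigr => k _.
  by rewrite !mxE enum_rankK.
rewrite -[RHS](rmorph0 (@ratr F)) -kq /act size_map_poly rmorph_sum.
by apply: eq_bigr => k _; rewrite coef_map rmorphM /= /lenF ratr_nat.
Qed.

Lemma uniform_len_recurrence (F : numFieldType) m c : (forall c, size (g c) = m) ->
  kills ('X - (m%:R)%:P) (@lenF F [:: c]).
Proof.
move=> gm n; rewrite actXsubC /lenF.
have -> : len n.+1 [:: c] = (m * len n [:: c])%N; last by rewrite natrM subrr.
rewrite /len /morph_iter iterS; set s := iter _ _ _; rewrite /morph_word size_flatten.
rewrite /shape -map_comp (eq_map (g := fun=> m)) //.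
by elim: s => [|x s IH]; rewrite ?muln0 //= IH mulnS.
Qed.

Lemma Un_cv_unshift (u : nat -> R) m l : Un_cv (fun n => u (m + n)%N) l -> Un_cv u l.
Proof.
move=> h eps /h[N HN]; exists (m + N)%N => n /ssrnat.leP le.
have le' := leq_trans (leq_addr _ _) le.
rewrite -(subnKC le'); apply: HN; apply/ssrnat.leP; by rewrite leq_subRL.
Qed.

Theorem affine_len_ratio (S T : nat -> nat) u y u' y' K :
  (0 < #|Sigma|)%N -> (forall c d e, d \in g c -> e \in g d -> e \in g c) ->
  affine_len S u y -> affine_len T u' y' ->
  (forall n, 0 < S n)%N -> (forall n, T n <= K * S n)%N -> (forall n, S n <= K * T n)%N ->
  exists xi : R, [/\ Un_cv (fun n => Rdiv (INR (T n)) (INR (S n))) xi,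
    algebraic_deg_le xi #|Sigma| & uniform_morph g -> is_rational xi].
Proof.
move=> Sig0 trg aS aT S0 TS ST; set N := #|Sigma|.
(* Used twice: with the polynomial of [len_recurrence], and with ['X - m] in the uniform case.
   Uniqueness of limits identifies the two values. *)
have main (chi : {poly rat}) : chi != 0 ->
    (forall c, kills (map_poly ratr chi) (@lenF R[i] [:: c])) ->
    exists xi l : R, [/\ Un_cv (fun n => Rdiv (INR (T n)) (INR (S n))) xi,
      root (map_poly ratr chi) l \/ l = 1 &
      exists P Q : {poly rat}, (map_poly ratr Q).[l] != 0 /\
      xi = (map_poly ratr P).[l] / (map_poly ratr Q).[l]].
  move=> chi0 kc.
  have X1 : map_poly ratr ('X - 1%:P) = 'X - 1%:P :> {poly R[i]}.
    by rewrite rmorphB /= map_polyX map_polyC /= rmorph1.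
  have X1R : map_poly ratr ('X - 1%:P) = 'X - 1%:P :> {poly R}.
    by rewrite rmorphB /= map_polyX map_polyC /= rmorph1.
  have shiftk f v z : affine_len f v z ->
      kills (map_poly ratr (chi * ('X - 1%:P))) (fun n => (f (N + n)%N)%:R : R[i]).
    move=> fa n; rewrite rmorphM /= X1 (act_shift _ (fun n => (f n)%:R)).
    exact: affine_len_kills fa kc _.
  have [|||||n|n|n|xi [l [lim rl _ PQ]]] := @recurrence_ratio_real (chi * ('X - 1%:P))
     (fun n => S (N + n)%N) (fun n => T (N + n)%N) K.
  - by rewrite mulf_neq0 // polyXsubC_eq0.
  - exact: shiftk aS.
  - exact: shiftk aT.
  - exact: (@affine_len_fwd_diff R[i] trg _ _ _ aS).
  - exact: (@affine_len_fwd_diff R[i] trg _ _ _ aT).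
  - exact: S0.
  - exact: TS.
  - exact: ST.
  exists xi, l; split=> //; first exact: Un_cv_unshift lim.
  move: rl; rewrite rmorphM /= X1R rootM => /orP[]; first by left.
  by rewrite root_XsubC => /eqP; right.
have [q [q0 sq kq]] := len_recurrence.
have [xi [l [lim rl [P [Q [Q0 exi]]]]]] := main q q0 (kq _).
exists xi; split=> //.
  case: rl => rl.
    have [r [r0 sr]] := algebraic_of_rational_function P q0 rl Q0.
    by rewrite -exi; apply: algebraic_deg_le_root => //; apply: leq_trans sq.
  have [||r [r0 sr]] := @algebraic_of_rational_function _ ('X - 1%:P) P Q l _ _ Q0.
  - by rewrite polyXsubC_eq0.
  - by rewrite rl rmorphB /= map_polyX map_polyC /= rmorph1 root_XsubC.
  by rewrite -exi; apply: algebraic_deg_le_root => //; rewrite (leq_trans sr) // size_XsubC.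
move=> [m gm]; have [||xi' [l' [lim' rl' [P' [Q' [Q0' exi']]]]]] := main ('X - (m%:R)%:P).
- by rewrite polyXsubC_eq0.
- move=> c; rewrite rmorphB /= map_polyX map_polyC /= ratr_nat.
  exact: uniform_len_recurrence.
have {}rl' : exists r : rat, l' = ratr r.
  case: rl' => [|->]; last by exists 1; rewrite rmorph1.
  by rewrite rmorphB /= map_polyX map_polyC /= root_XsubC => /eqP ->; exists m%:R.
case: rl' => r er; rewrite (UL_sequence _ _ _ lim lim') exi' er !horner_map -fmorphV -rmorphM.
exact: is_rational_ratr.
Qed.

End Lengths.

Local Close Scope ring_scope.
Local Open Scope nat_scope.

(** * Blocks in a fixed point *)

Section Prefix.
Variables (T : Type) (w : nat -> T).

Lemma mkseq_add m n : mkseq w (m + n) = mkseq w m ++ map w (iota m n).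
Proof. by rewrite /mkseq iotaD map_cat add0n. Qed.

Lemma mkseqS n : mkseq w n.+1 = mkseq w n ++ [:: w n].
Proof. by rewrite -addn1 mkseq_add. Qed.

Lemma mkseq_prefix s t : s ++ t = mkseq w (size (s ++ t)) -> s = mkseq w (size s).
Proof.
move=> /(congr1 (take (size s))); rewrite take_size_cat // size_cat mkseq_add.
by rewrite take_size_cat // size_mkseq.
Qed.

End Prefix.

Section FixpointWord.
Variables (Sigma : finType) (h : Sigma -> seq Sigma) (a : Sigma).
Hypothesis ha : prolongable h a.
Let w := fixpoint_word h a.

Lemma morph_iter_prolong m : exists2 y, morph_iter h m.+1 [:: a] = morph_iter h m [:: a] ++ y & y <> [::].
Proof.
have [x [hx [_ xn]]] := ha; exists (morph_iter h m x) => //.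
rewrite -morph_iter_cat /morph_iter iterSr /=; congr (iter _ _ _).
by rewrite /morph_word /= cats0.
Qed.

Lemma size_morph_iter_prolong m : m < size (morph_iter h m [:: a]).
Proof.
elim: m => // m IH; have [y -> y0] := morph_iter_prolong m.
by rewrite size_cat -addn1 leq_add //; case: (y) y0.
Qed.

(** The iterates on [a] are prefixes of one another, so the iterate defining letter [n] may be
    exchanged for any other that is long enough. *)
Lemma morph_iter_fixpoint m :
  morph_iter h m [:: a] = mkseq w (size (morph_iter h m [:: a])).
Proof.
have nth_ext k n : n < size (morph_iter h m [:: a]) ->
    nth a (morph_iter h (m + k) [:: a]) n = nth a (morph_iter h m [:: a]) n.
  elim: k m => [|k IH] m' lt; first by rewrite addn0.
  rewrite addnS -addSn; have [y e _] := morph_iter_prolong m'.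
  by rewrite IH e ?size_cat ?nth_cat ?lt // ltn_addr.
apply: (@eq_from_nth _ a) => [|n lt]; first by rewrite size_mkseq.
rewrite nth_mkseq // /w /fixpoint_word.
have [le|le] := leqP m n.+1; first by rewrite -(subnKC le) nth_ext.
rewrite -(subnKC (ltnW le)).
have lt2 := ltnW (size_morph_iter_prolong n.+1).
elim: (m - n.+1) => [|k IH]; first by rewrite addn0.
rewrite addnS; have [y -> _] := morph_iter_prolong (n.+1 + k).
rewrite nth_cat -IH ifT //.
by have := size_morph_iter_prolong (n.+1 + k); apply: leq_ltn_trans; rewrite addSn ltnW // ltnS leq_addr.
Qed.

(** The fixed point property in finite form: the prefix of length [n] extends to [h^n(a)], whose
    image [h^(n+1)(a)] is again a prefix of [w]. *)
Lemma morph_word_fixpoint n :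
  morph_word h (mkseq w n) = mkseq w (size (morph_word h (mkseq w n))).
Proof.
have lt := size_morph_iter_prolong n.
have e := morph_iter_fixpoint n; have e1 := morph_iter_fixpoint n.+1.
move: e1; rewrite /morph_iter iterS -/(morph_iter h n _) {1 2}e.
rewrite -(subnKC (ltnW lt)) mkseq_add morph_word_cat.
exact: mkseq_prefix.
Qed.

End FixpointWord.

(** * First and last letters outside a subalphabet *)

Section Index.
Variables (T : finType) (D : {set T}).
Implicit Types (s : seq T).

Definition fst_out s := find (fun c => c \notin D) s.
(** On a word over [D] truncated subtraction gives 0, so the value never exceeds the size. *)
Definition lst_out s := size s - (find (fun c => c \notin D) (rev s)).+1.

Lemma fst_outP x0 s : ~~ all (mem D) s ->
  [/\ fst_out s < size s, nth x0 s (fst_out s) \notin D &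
      forall j, j < fst_out s -> nth x0 s j \in D].
Proof.
rewrite -has_predC => hs; split; first by rewrite -has_find.
  exact: (nth_find x0 hs).
by move=> j /(before_find x0)/negbFE.
Qed.

Lemma lst_outP x0 s : ~~ all (mem D) s ->
  [/\ lst_out s < size s, nth x0 s (lst_out s) \notin D &
      forall j, lst_out s < j < size s -> nth x0 s j \in D].
Proof.
rewrite -has_predC -has_rev => hs.
have lt : find (fun c => c \notin D) (rev s) < size s by rewrite -[size s]size_rev -has_find.
split; first by rewrite /lst_out; lia.
  by rewrite /lst_out -nth_rev //; apply: (nth_find x0 hs).
move=> j /andP[j1 j2]; have := @before_find _ x0 (fun c => c \notin D) (rev s) (size s - j.+1).
rewrite nth_rev; last by lia.
rewrite (_ : size s - (size s - j.+1).+1 = j); last by lia.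
by move=> /(_ _)/negbFE; apply; rewrite /lst_out in j1; lia.
Qed.
End Index.

(** * Gaps between letters outside a subalphabet, and their descent *)

Section Gaps.
Variables (Sigma : finType) (g : Sigma -> seq Sigma) (w : nat -> Sigma).
Hypothesis fixw : forall n, morph_word g (mkseq w n) = mkseq w (size (morph_word g (mkseq w n))).

Definition pos n := size (morph_word g (mkseq w n)).

Lemma posS n : pos n.+1 = pos n + size (g (w n)).
Proof. by rewrite /pos mkseqS morph_word_cat size_cat {2}/morph_word /= cats0. Qed.

Lemma w_pos n k : k < size (g (w n)) -> w (pos n + k) = nth (w 0) (g (w n)) k.
Proof.
move=> lt; have := fixw n.+1; rewrite -/(pos n.+1) posS mkseqS morph_word_cat.
rewrite {2}/morph_word /= cats0 => e.
have := congr1 (fun s => nth (w 0) s (pos n + k)) e.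
rewrite nth_mkseq ?ltn_add2l // => <-.
by rewrite nth_cat -/(pos n) ltnNge leq_addr /= addKn.
Qed.

Lemma pos_mono m n : m <= n -> pos m <= pos n.
Proof.
elim: n => [|n IH]; first by rewrite leqn0 => /eqP ->.
rewrite leq_eqVlt => /predU1P[-> //|/IH le]; by rewrite posS (leq_trans le) ?leq_addr.
Qed.

Definition step (sigma : Sigma -> nat) q := pos q + sigma (w q).

Lemma mkseq_step sigma q : sigma (w q) <= size (g (w q)) ->
  mkseq w (step sigma q) = morph_word g (mkseq w q) ++ take (sigma (w q)) (g (w q)).
Proof.
move=> le; rewrite /step.
have e := fixw q.+1; rewrite -/(pos q.+1) mkseqS morph_word_cat {2}/morph_word /= cats0 in e.
have e2 : pos q.+1 = size ((morph_word g (mkseq w q) ++ take (sigma (w q)) (g (w q))) ++ drop (sigma (w q)) (g (w q))).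
  by rewrite -catA cat_take_drop size_cat posS.
have := @mkseq_prefix _ w (morph_word g (mkseq w q) ++ take (sigma (w q)) (g (w q))) (drop (sigma (w q)) (g (w q))).
rewrite -e2 -catA cat_take_drop => /(_ e) ->.
by rewrite size_cat size_take_min (minn_idPl le).
Qed.

(** Let [t] be the part of [g (w q)] left of the chosen letter. The prefix before the [n]-th
    descendant is [g^n] of the prefix before [q], followed by [g^(n-1)(t)], ..., [g(t)], [t]. The
    last step, with [sigma'], applies [g] once more and adds a constant. *)
Lemma chain_affine (sigma sigma' : Sigma -> nat) q :
  (forall c, sigma c <= size (g c)) ->
  (forall n, w (iter n (step sigma) q) = w q) ->
  affine_len g (fun n => step sigma' (iter n (step sigma) q))
    (morph_word g (mkseq w q)) (morph_word g (take (sigma (w q)) (g (w q)))).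
Proof.
move=> le wq; set y := take _ _; set V := fun n => iter n (step sigma) q.
have VS m n : len g m (mkseq w (V n.+1)) = len g m.+1 (mkseq w (V n)) + len g m y.
  by rewrite /V iterS mkseq_step ?le // len_cat -lenS wq.
(* Stated for all [m], because the induction trades a step of descent for an application of [g]. *)
have key m n : len g m (mkseq w (V n.+1)) + len g (m + n) (mkseq w q) =
    len g m (mkseq w (V n)) + len g (m + n).+1 (mkseq w q) + len g (m + n) y.
  elim: n m => [|n IH] m; first by rewrite VS addn0 /=; lia.
  by have := IH m.+1; rewrite !VS addnS addSn; lia.
move=> n; rewrite -!lenS; have := key 1 n; rewrite /step -/(V n) -/(V n.+1) !wq.
by rewrite add1n -![pos _]/(len g 1 (mkseq w _)); lia.
Qed.

Lemma len_mkseq_mono n p q : p <= q -> len g n (mkseq w p) <= len g n (mkseq w q).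
Proof. by move=> le; rewrite -(subnKC le) mkseq_add len_cat leq_addr. Qed.

(** Descendants of [q] stay in the iterated image of the letter [w q]. This bound and [chain_upper]
    do not ask the letters to be stable. *)
Lemma chain_lower sigma sigma' q n :
  len g n.+1 (mkseq w q) <= step sigma' (iter n (step sigma) q).
Proof.
apply: leq_trans (leq_addr _ _).
suff H m : len g (n + m) (mkseq w q) <= len g m (mkseq w (iter n (step sigma) q)).
  by have := H 1; rewrite addn1.
elim: n m => // n IH m; rewrite addSnnS; apply: leq_trans (IH _) _.
by rewrite iterS lenS fixw; apply: len_mkseq_mono; apply: leq_addr.
Qed.

Lemma chain_upper sigma sigma' q n :
  (forall c, c \in [seq w (iter k (step sigma) q) | k <- iota 0 n] -> sigma c < size (g c)) ->
  sigma' (w (iter n (step sigma) q)) < size (g (w (iter n (step sigma) q))) ->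
  step sigma' (iter n (step sigma) q) < len g n.+1 (mkseq w q.+1).
Proof.
move=> le le'; set r := iter n _ _ in le' *.
apply: (@leq_trans (len g 1 (mkseq w r.+1))).
  by rewrite -[len _ _ _]/(pos _) posS ltn_add2l.
suff H m : len g m (mkseq w r.+1) <= len g (n + m) (mkseq w q.+1).
  by have := H 1; rewrite addn1.
rewrite /r; elim: n m {r le'} le => // n IH m le; rewrite addSnnS.
apply: leq_trans (IH _ _); last first.
  by move=> c cn; apply: le; rewrite -addn1 iotaD map_cat mem_cat cn.
rewrite iterS lenS fixw; apply: len_mkseq_mono; rewrite -/(pos _) posS ltn_add2l.
by apply: le; apply/mapP; exists n => //; rewrite mem_iota /= add0n.
Qed.

Lemma morph_iter_mkseq m n : morph_iter g m (mkseq w n) = mkseq w (len g m (mkseq w n)).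
Proof.
elim: m n => [|m IH] n; first by rewrite /len /= size_mkseq.
by rewrite /morph_iter iterSr lenS fixw -/(morph_iter g m _) IH.
Qed.

Lemma count_len c s n : count_mem c s * len g n [:: c] <= len g n s.
Proof.
elim: s => // d s IH; rewrite -cat1s len_cat /= mulnDl leq_add //.
by case: eqP => [->|_] //; rewrite mul1n.
Qed.

(* A letter far away occurs infinitely often, hence many times in any long
   prefix; this makes the estimate uniform in [n]. *)
Lemma far_letter_small C : exists S0, forall q l n, S0 <= q -> S0 <= l ->
  C * len g n [:: w q] <= len g n (mkseq w l).
Proof.
have ex (c : Sigma) : exists S, (forall q, S <= q -> w q != c) \/ C <= count_mem c (mkseq w S).
  have [[S fin]|inf] := classic (exists S, forall q, S <= q -> w q != c).
    by exists S; left.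
  have many k : exists S, k <= count_mem c (mkseq w S).
    elim: k => [|k [S IH]]; first by exists 0.
    have [q le wq] : exists2 q, S <= q & w q = c.
      apply: NNPP => no; apply: inf; exists S => q le; apply/negP => /eqP e.
      by apply: no; exists q.
    exists q.+1; rewrite mkseqS count_cat /= wq eqxx addn0 addn1 ltnS.
    by apply: leq_trans IH _; rewrite -(subnKC le) mkseq_add count_cat leq_addr.
  by have [S HS] := many C; exists S; right.
have [S HS] := fin_all_exists ex; exists (\max_c S c) => q l n lq ll.
have le c : S c <= \max_c S c by apply: leq_bigmax.
have [fin|cnt] := HS (w q).
  by have := fin q (leq_trans (le _) lq); rewrite eqxx.
apply: leq_trans (len_mkseq_mono n (leq_trans (le (w q)) ll)).
by apply: leq_trans (count_len (w q) _ n); rewrite leq_mul2r cnt orbT.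
Qed.

(** Each of the [m] letters beyond a far [l] adds at most the fraction [1 / C] of the prefix. *)
Lemma far_segment_small C : exists S0, forall l m n, S0 <= l ->
  C * len g n (mkseq w (l + m)) <= (C + m) * len g n (mkseq w l).
Proof.
have [S0 H] := far_letter_small C; exists S0 => l m n le.
rewrite mkseq_add len_cat mulnDr mulnDl leq_add2l.
elim: m => [|m IH]; first by rewrite len_nil muln0.
rewrite -addn1 iotaD map_cat len_cat mulnDr mulnDl mul1n leq_add //.
by apply: H => //; apply: leq_trans le (leq_addr _ _).
Qed.

Hypothesis g_gt0 : forall c, 0 < size (g c).

Lemma parent i : exists n k, k < size (g (w n)) /\ i = pos n + k.
Proof.
elim: i => [|i [n [k [lt ->]]]]; first by exists 0, 0; split.
have [lt'|ge] := ltnP k.+1 (size (g (w n))).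
  by exists n, k.+1; rewrite addnS.
exists n.+1, 0; split=> //; rewrite posS addn0 -addnS; congr (_ + _).
by apply/eqP; rewrite eqn_leq lt ge.
Qed.

(** The delimiters of a possibly empty [D]-block: unlike the ends of the block, they are letters
    whose ancestors can be followed. *)
Definition gap (D : {set Sigma}) l e :=
  [/\ l < e, w l \notin D, w e \notin D & forall t, l < t < e -> w t \in D].

Definition preim_sub (D : {set Sigma}) := [set c | all (mem D) (g c)].

Definition stepL D := step (fun c => lst_out D (g c)).

Definition stepF D := step (fun c => fst_out D (g c)).

Lemma gap_image D l e : gap (preim_sub D) l e -> gap D (stepL D l) (stepF D e).
Proof.
case=> lt; rewrite !inE => wl we btw.
have [l1 l2 l3] := lst_outP (w 0) wl; have [e1 e2 e3] := fst_outP (w 0) we.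
have le := pos_mono lt; rewrite posS in le.
split; rewrite /stepL /stepF /step ?w_pos //; first by lia.
move=> t /andP[t1 t2]; have [n [k [kn et]]] := parent t.
rewrite et w_pos //.
have [nl|ln|enl] := ltngtP n l.
- have := pos_mono nl; rewrite posS; lia.
- have [ne|en|ene] := ltngtP n e.
  + have := btw n; rewrite ln ne inE => /(_ isT)/(all_nthP (w 0)); exact.
  + have := pos_mono en; rewrite posS; lia.
  + by subst n; apply: e3; lia.
by subst n; apply: l3; rewrite kn andbT; lia.
Qed.

Lemma gap_iter D l e n : preim_sub D = D -> gap D l e ->
  gap D (iter n (stepL D) l) (iter n (stepF D) e).
Proof. by move=> eD ge; elim: n => //= n IH; apply: gap_image; rewrite eD. Qed.

Hypothesis g_gt1 : 1 < size (g (w 0)).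

Lemma pos_gt n : 0 < n -> n < pos n.
Proof.
case: n => // n _; elim: n => [|n IH]; first by rewrite posS /pos /=.
by rewrite posS -addn1 leq_add.
Qed.

Lemma pos_ge n : n <= pos n.
Proof. by case: n => // n; apply/ltnW/pos_gt. Qed.

Lemma len_gt m : m < len g m [:: w 0].
Proof.
elim: m => // m IH; have := morph_iter_mkseq m 1; rewrite [mkseq w 1]/= => e.
have -> : len g m.+1 [:: w 0] = pos (len g m [:: w 0]).
  by rewrite {1}/len /morph_iter iterS -/(morph_iter g m _) e.
by apply: leq_ltn_trans (pos_gt _) => //; apply: leq_ltn_trans IH.
Qed.

Variable K : nat.
Hypothesis g_le : forall c, size (g c) <= K.

(** Converse of [gap_image]: ends at distance at least [K] do not come from one letter, so their
    parents differ, and the letters between the parents have their images inside the gap. *)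
Lemma gap_parent D l e : gap D l e -> l + K <= e -> exists l0 e0,
  [/\ gap (preim_sub D) l0 e0, l = stepL D l0, e = stepF D e0 & e0 < e].
Proof.
case=> lt wl we btw leK.
have [l0 [k [kl el]]] := parent l; have [e0 [k' [ke ee]]] := parent e.
have lt0 : l0 < e0.
  rewrite ltnNge; apply/negP; rewrite leq_eqVlt => /predU1P[e'|lt'].
    by subst e0; have := g_le (w l0); lia.
  by have := pos_mono lt'; rewrite posS; lia.
have P1 := pos_mono lt0; rewrite posS in P1.
have wl0 : ~~ all (mem D) (g (w l0)).
  apply: contra wl => /(all_nthP (w 0)) h; rewrite el w_pos //; exact: h.
have we0 : ~~ all (mem D) (g (w e0)).
  apply: contra we => /(all_nthP (w 0)) h; rewrite ee w_pos //; exact: h.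
have [l1 l2 l3] := lst_outP (w 0) wl0; have [e1 e2 e3] := fst_outP (w 0) we0.
exists l0, e0; split.
- split=> //; rewrite ?inE // => t /andP[t1 t2]; rewrite inE.
  apply/(all_nthP (w 0)) => i it; rewrite -w_pos //; apply: btw.
  have := pos_mono t1; have := pos_mono t2; rewrite !posS; lia.
- rewrite /stepL /step el; congr (_ + _); have [c|c|//] := ltngtP k (lst_out D (g (w l0))).
    have := btw (pos l0 + lst_out D (g (w l0))); rewrite w_pos // (negbTE l2) => H.
    by have : false by apply: H; lia.
  by have := l3 k; rewrite c kl -w_pos // -el (negbTE wl) => /(_ isT).
- rewrite /stepF /step ee; congr (_ + _); have [c|c|//] := ltngtP k' (fst_out D (g (w e0))).
    by have := e3 k' c; rewrite -w_pos // -ee (negbTE we).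
  have := btw (pos e0 + fst_out D (g (w e0))); rewrite w_pos // (negbTE e2) => H.
  by have : false by apply: H; lia.
by rewrite ee (leq_trans (pos_gt _)) ?leq_addr // (leq_ltn_trans _ lt0).
Qed.

Lemma gap_root D l e : preim_sub D = D -> gap D l e -> exists l0 e0 n,
  [/\ gap D l0 e0, e0 < l0 + K, l = iter n (stepL D) l0 & e = iter n (stepF D) e0].
Proof.
move=> eD; have [m] := ubnP e; elim: m l e => // m IH l e lt ge.
have [small|big] := ltnP e (l + K); first by exists l, e, 0.
have [l1 [e1 [g1 -> ee lt1]]] := gap_parent ge big; rewrite eD in g1.
have [|l0 [e0 [n [g0 s0 -> e1E]]]] := IH l1 e1 _ g1; first by lia.
by exists l0, e0, n.+1; split=> //; rewrite ee e1E.
Qed.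

Lemma size_morph_word_le s : size (morph_word g s) <= K * size s.
Proof.
elim: s => // c s IH; rewrite /morph_word /= size_cat mulnS leq_add ?g_le //.
Qed.

Lemma lenS_le n s : len g n.+1 s <= K * len g n s.
Proof. by rewrite /len /morph_iter iterS size_morph_word_le. Qed.

(** [g^q] of the first letter has more than [q] letters, hence covers the prefix of length [q]; each
    of these [q] iterations multiplies lengths by at most [K]. *)
Lemma len_growth q : exists K', forall n, len g n (mkseq w q) <= K' * len g n [:: w 0].
Proof.
exists (K ^ q) => n.
have le : len g n (mkseq w q) <= len g (n + q) [:: w 0].
  have -> : len g (n + q) [:: w 0] = len g n (morph_iter g q (mkseq w 1)).
    by rewrite /len /morph_iter -iterD.
  by rewrite morph_iter_mkseq len_mkseq_mono // ltnW // len_gt.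
apply: leq_trans le _; elim: q => [|q IH]; first by rewrite addn0 expn0 mul1n.
by rewrite addnS (leq_trans (lenS_le _ _)) // expnS -mulnA leq_mul.
Qed.

End Gaps.

(** * Stable first and last letters; idempotent powers *)

Section Profile.
Variable Sigma : finType.
Implicit Types (s t : seq Sigma) (Gamma D : {set Sigma}).

Definition ofirst Gamma s := ohead [seq c <- s | c \notin Gamma].

Lemma ofirst_cat Gamma s t :
  ofirst Gamma (s ++ t) = if ofirst Gamma s is Some c then Some c else ofirst Gamma t.
Proof. by rewrite /ofirst filter_cat; case: [seq c <- s | _]. Qed.

Lemma ofirst_None Gamma s : (ofirst Gamma s == None) = all (mem Gamma) s.
Proof.
by elim: s => //= c s <-; rewrite /ofirst /=; case: (boolP (c \in Gamma)).
Qed.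

Lemma ofirst_fst_out x0 D s : ~~ all (mem D) s ->
  ofirst D s = Some (nth x0 s (fst_out D s)).
Proof.
elim: s => //= c s IH; rewrite negb_and /ofirst /fst_out /=.
by have [cD /= h|] := boolP (c \in D); first exact: IH.
Qed.

Lemma nth_lst_out x0 D s : ~~ all (mem D) s ->
  nth x0 s (lst_out D s) = nth x0 (rev s) (fst_out D (rev s)).
Proof.
rewrite -has_predC -has_rev => hs; rewrite nth_rev //.
by rewrite -[size s]size_rev -has_find.
Qed.

Definition rev_morph (g : Sigma -> seq Sigma) c := rev (g c).

Lemma rev_morph_word g s : rev (morph_word g s) = morph_word (rev_morph g) (rev s).
Proof. by rewrite /morph_word rev_flatten -map_comp map_rev. Qed.

Lemma all_morph_word D g s :
  all (mem D) (morph_word g s) = all (fun c => all (mem D) (g c)) s.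
Proof. by elim: s => //= c s <-; rewrite -all_cat. Qed.

(** The letters of [g c] before [d] lie in [D], and so do their images. The first letter of
    [g (g c)] outside [D] is thus that of [g d], and idempotence says that it is [d]. *)
Lemma first_out_idem g D x0 : (forall c, (c \in D) = all (mem D) (g c)) ->
  (forall c, ofirst D (g c) = ofirst D (morph_word g (g c))) ->
  forall c, c \notin D -> let d := nth x0 (g c) (fst_out D (g c)) in
  nth x0 (g d) (fst_out D (g d)) = d.
Proof.
move=> hD idem c cD /=; have := cD; rewrite hD => nc.
have [f1 f2 f3] := fst_outP x0 nc; set s := g c in nc f1 f2 f3 *.
set k := fst_out D s in f1 f2 f3 *; set d := nth x0 s k in f2 *.
have es : s = take k s ++ d :: drop k.+1 s by rewrite -drop_nth // cat_take_drop.
have nd : ~~ all (mem D) (g d) by rewrite -hD.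
have e := idem c; rewrite -/s {2}es morph_word_cat ofirst_cat in e.
have t0 : ofirst D (morph_word g (take k s)) = None.
  apply/eqP; rewrite ofirst_None all_morph_word.
  apply/(all_nthP x0) => i; rewrite size_take f1 => ik /=.
  by rewrite -hD nth_take // f3.
rewrite t0 -cat1s morph_word_cat ofirst_cat {1}/morph_word /= cats0 in e.
by move: e; rewrite (ofirst_fst_out x0 nd) (ofirst_fst_out x0 nc) => -[].
Qed.

Lemma ofirst_morph_iter h n Gamma s : ofirst Gamma (morph_iter h n s) =
  ohead (pmap (fun d => ofirst Gamma (morph_iter h n [:: d])) s).
Proof.
elim: s => [|d s IH] /=.
  by elim: n => // n IH; rewrite /morph_iter iterSr.
by rewrite -cat1s morph_iter_cat ofirst_cat IH /oapp; case: (ofirst _ _).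
Qed.

Lemma ofirst_rev_morph_iter h n Gamma s : ofirst Gamma (rev (morph_iter h n s)) =
  ohead (pmap (fun d => ofirst Gamma (rev (morph_iter h n [:: d]))) (rev s)).
Proof.
elim: s => [|d s IH] /=.
  by elim: n => // n IH; rewrite /morph_iter iterSr.
rewrite -cat1s morph_iter_cat !rev_cat ofirst_cat IH pmap_cat.
by case: (pmap _ (rev s)) => //=; case: (ofirst _ _).
Qed.

Lemma iter_idempotent (T : finType) (f : T -> T) x :
  exists2 p, 0 < p & iter (p + p) f x = iter p f x.
Proof.
have /trajectP[i lt e] := looping_order f x.
set q := order f x - i; have q0 : 0 < q by rewrite subn_gt0.
have per m k : i <= m -> iter (m + q * k) f x = iter m f x.
  move=> im; elim: k => [|k IH]; first by rewrite muln0 addn0.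
  rewrite mulnS (_ : m + (q + q * k) = (m - i + q * k) + order f x); last by lia.
  rewrite iterD e -iterD -[RHS]IH; congr (iter _ f x); lia.
(* A multiple of the period that also reaches past the preperiod [i]. *)
exists (q * i.+1); first by rewrite muln_gt0 q0.
by apply: per; apply: leq_trans (leqnSn i) _; rewrite leq_pmull.
Qed.

(* These data for [h^(n+1)] are determined by those for [h^n], so they run
   through an orbit in a finite set. *)
Lemma idempotent_power (h : Sigma -> seq Sigma) : exists2 p, 0 < p &
  forall Gamma c,
    ofirst Gamma (morph_iter h (p + p) [:: c]) = ofirst Gamma (morph_iter h p [:: c]) /\
    ofirst Gamma (rev (morph_iter h (p + p) [:: c])) = ofirst Gamma (rev (morph_iter h p [:: c])).
Proof.
pose profile n : {ffun Sigma * {set Sigma} -> option Sigma * option Sigma} :=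
  [ffun x => (ofirst x.2 (morph_iter h n [:: x.1]), ofirst x.2 (rev (morph_iter h n [:: x.1])))].
pose Phi (t : {ffun Sigma * {set Sigma} -> option Sigma * option Sigma}) :
    {ffun Sigma * {set Sigma} -> option Sigma * option Sigma} :=
  [ffun x => (ohead (pmap (fun d => (t (d, x.2)).1) (h x.1)),
              ohead (pmap (fun d => (t (d, x.2)).2) (rev (h x.1))))].
have profE n : profile n = iter n Phi (profile 0).
  elim: n => // n IH; rewrite iterS -IH; apply/ffunP => -[c Gamma]; rewrite !ffunE /=.
  have -> : morph_word h (iter n (morph_word h) [:: c]) = morph_iter h n (h c).
    by rewrite -iterS iterSr {2}/morph_word /= cats0.
  rewrite ofirst_morph_iter ofirst_rev_morph_iter.
  by congr (ohead _, ohead _); apply: eq_pmap => d; rewrite ffunE.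
have [p p0 e] := iter_idempotent Phi (profile 0).
exists p => // Gamma c; move: e; rewrite -!profE => /ffunP/(_ (c, Gamma)).
by rewrite !ffunE /= => -[].
Qed.

End Profile.

(** * The limsup over all lines of descent *)

Section Limsup.
Local Open Scope R_scope.
(** [root l e] stands for a gap where a line of descent starts, [S l n] and [T e n] for the ends of
    the block reached after [n] steps, and [Good] for the arithmetic property to be carried over to
    the limsup. *)
Variables (i j : nat -> nat) (root : nat -> nat -> Prop) (S T : nat -> nat -> nat) (K : nat).
Hypothesis i_incr : forall k, (i k < i k.+1)%N.
Hypothesis ij : forall k, (i k <= j k)%N.
Hypothesis root_fun : forall l e e', root l e -> root l e' -> e = e'.
Hypothesis block_root : forall k, (0 < i k)%N -> (j k <= i k + K)%N \/
  exists l e n, [/\ root l e, i k = S l n & j k = T e n].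
Hypothesis root_block : forall l e n, root l e -> (S l n <= T e n)%N ->
  exists k, i k = S l n /\ j k = T e n.
Hypothesis S_gt : forall l e n, root l e -> (n < S l n)%N.
Hypothesis far_small : forall C, exists S0, forall l e n, root l e -> (S0 <= l)%N ->
  (C * T e n <= (C + K) * S l n)%N.
Variable Good : R -> Prop.
Hypothesis Good1 : Good 1.
Hypothesis chain_lim : forall l e, root l e ->
  exists2 x, Un_cv (fun n => INR (T e n) / INR (S l n)) x & Good x.

Let ratio l e n := INR (T e n) / INR (S l n).
Let A l x := exists2 e, root l e & Un_cv (ratio l e) x.

Lemma i_ge k : (k <= i k)%N.
Proof. by elim: k => // k IH; apply: leq_ltn_trans IH (i_incr k). Qed.

Lemma i_mono k m : (k < m)%N -> (i k < i m)%N.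
Proof.
elim: m => // m IH; rewrite ltnS leq_eqVlt => /predU1P[-> //|/IH lt].
exact: ltn_trans lt (i_incr m).
Qed.

Lemma INR_leq m n : (m <= n)%N -> INR m <= INR n.
Proof. by move=> le; apply/le_INR/ssrnat.leP. Qed.

Lemma INR_gt0 n : (0 < n)%N -> 0 < INR n.
Proof. by move=> lt; apply/lt_0_INR/ssrnat.ltP. Qed.

(** Each [l] determines [e] and hence at most one limit, so only finitely many limits compete. *)
Lemma A_max B : (forall l x, (l < B)%N -> A l x -> x <= 1) \/
  exists l x, [/\ A l x, 1 < x & forall l' y, (l' < B)%N -> A l' y -> y <= x].
Proof.
have uniq l x y : A l x -> A l y -> x = y.
  move=> [e re cx] [e' re' cy]; rewrite -(root_fun re re') in cy.
  exact: UL_sequence cx cy.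
elim: B => [|B IH]; first by left.
have [[x [Ax x1]]|no] := classic (exists x, A B x /\ 1 < x).
  right; case: IH => [le1|[l [y [Ay y1 max]]]].
    exists B, x; split=> // l' y; rewrite ltnS leq_eqVlt => /predU1P[-> Ay|lt Ay].
      by rewrite (uniq _ _ _ Ay Ax); lra.
    by have := le1 _ _ lt Ay; lra.
  have [yx|xy] := Rle_lt_dec y x.
    exists B, x; split=> // l' z; rewrite ltnS leq_eqVlt => /predU1P[-> Az|lt Az].
      by rewrite (uniq _ _ _ Az Ax); lra.
    by have := max _ _ lt Az; lra.
  exists l, y; split=> // l' z; rewrite ltnS leq_eqVlt => /predU1P[-> Az|lt Az].
    by rewrite (uniq _ _ _ Az Ax); lra.
  exact: max lt Az.
case: IH => [le1|[l [y [Ay y1 max]]]].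
  left=> l x; rewrite ltnS leq_eqVlt => /predU1P[-> Ax|lt Ax]; last exact: le1 lt Ax.
  by have [//|lt] := Rle_lt_dec x 1; case: no; exists x.
right; exists l, y; split=> // l' z; rewrite ltnS leq_eqVlt => /predU1P[-> Az|lt Az]; last exact: max lt Az.
have [le|lt] := Rle_lt_dec z 1; first by lra.
by case: no; exists z.
Qed.

Lemma far_ratio d : 0 < d -> exists S0, forall l e n, root l e -> (S0 <= l)%N ->
  ratio l e n <= 1 + d.
Proof.
(* [C * d > K] brings the factor [(C + K) / C] below [1 + d]. *)
move=> d0; have [C HC] := INR_archimed d (INR K) d0.
have [S0 H] := far_small C.+1; exists S0 => l e n re le.
have S0' := INR_gt0 (leq_ltn_trans (leq0n n) (S_gt n re)).
have := INR_leq (H l e n re le); rewrite !mult_INR plus_INR S_INR => h.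
have h2 : INR K < d * (INR C + 1) by lra.
have C0 := pos_INR C.
apply: (Rmult_le_reg_r (INR (S l n))) => //.
rewrite /ratio /Rdiv Rmult_assoc Rinv_l ?Rmult_1_r; last by lra.
nra.
Qed.

Lemma limsup_upper L eps S0 : 1 <= L -> 0 < eps ->
  (forall l e n, root l e -> (S0 <= l)%N -> ratio l e n < L + eps) ->
  (forall l x, (l < S0)%N -> A l x -> x <= L) ->
  exists N, forall k, (N <= k)%N -> INR (j k) / INR (i k) < L + eps.
Proof.
move=> L1 e0 far near.
have [N0 HN0] : exists N0, forall l e n, (l < S0)%N -> root l e -> (N0 <= n)%N -> ratio l e n < L + eps.
  elim: (S0) near => [|B IH] near; first by exists 0%N.
  have [|N1 H1] := IH; first by move=> l x lt; apply: near; apply: ltnW.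
  have [[e re]|no] := classic (exists e, root B e); last first.
    exists N1 => l e n; rewrite ltnS leq_eqVlt => /predU1P[-> re|]; last exact: H1.
    by case: no; exists e.
  have [x cx _] := chain_lim re.
  have xL : x <= L by apply: (near B) => //; exists e.
  have [N2 H2] := cx eps e0.
  exists (maxn N1 N2) => l e' n lt re'; rewrite geq_max => /andP[n1 n2].
  move: lt; rewrite ltnS leq_eqVlt => /predU1P[el|lt]; last exact: H1 re' n1.
  rewrite {}el in re' *; rewrite -(root_fun re re').
  have := H2 n; rewrite /Rdist => /(_ (elimT ssrnat.leP n2)) /Rabs_def2[h _].
  by rewrite /ratio; lra.
(* Blocks met before step [N0] on near lines start at [Bd] or earlier, so later blocks avoid them;
   [M] below plays the same part for blocks of bounded length. *)
set Bd := (\max_(l < S0) \max_(n < N0) S l n)%N.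
have HBd l n : (l < S0)%N -> (n < N0)%N -> (S l n <= Bd)%N.
  move=> ll ln; apply: leq_trans (@leq_bigmax_cond _ xpredT (fun l : 'I_S0 => \max_(n < N0) S l n)%N (Ordinal ll) isT).
  exact: (@leq_bigmax_cond _ xpredT (fun n : 'I_N0 => S l n) (Ordinal ln) isT).
have [M HM] := INR_archimed eps (INR K) e0.
exists (maxn Bd M).+1 => k le.
have ik : (maxn Bd M < i k)%N := leq_trans le (i_ge k).
have i0 := INR_gt0 (leq_ltn_trans (leq0n _) ik).
have [small|[l [e [n [re iS jT]]]]] := block_root (leq_ltn_trans (leq0n _) ik).
  have iM := INR_leq (leq_trans (leq_maxr Bd M) (ltnW ik)).
  have := INR_leq small; rewrite plus_INR => h.
  apply: (Rmult_lt_reg_r (INR (i k))) => //.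
  rewrite /Rdiv Rmult_assoc Rinv_l ?Rmult_1_r; last by lra.
  nra.
rewrite iS jT -/(ratio l e n); have [lt|ge] := ltnP l S0; last exact: far.
have [nN|nN] := ltnP n N0; last exact: HN0.
by have := HBd l n lt nN; rewrite -iS leqNgt (leq_ltn_trans (leq_maxl Bd M) ik).
Qed.

Theorem limsup_blocks : exists L, is_limsup (fun k => INR (j k) / INR (i k)) L /\ Good L.
Proof.
have [[l [x [Ax x1]]]|no] := classic (exists l x, A l x /\ 1 < x).
  (* With this margin far lines stay below [x]; the bound [l.+1] then keeps the line of [x] itself
     among those compared. *)
  have [S0 HS0] := @far_ratio ((x - 1) / 2) ltac:(lra).
  have [le1|[l0 [L [AL L1 max]]]] := A_max (maxn S0 l.+1).
    by have := le1 l x (leq_maxr _ _) Ax; lra.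
  have xL : x <= L := max l x (leq_maxr _ _) Ax.
  case: (AL) => e0 re0 cL; exists L; split; last first.
    have [y cy gy] := chain_lim re0; by rewrite (UL_sequence _ _ _ cL cy).
  move=> eps eps0; split.
    apply: (@limsup_upper L eps (maxn S0 l.+1)) => //; first by lra.
    move=> l' e n re; rewrite geq_max => /andP[le _].
    by have := HS0 l' e n re le; lra.
  (* The cap [L - 1] keeps the ratio above 1, so the gap encloses a nonempty block, which the
     enumeration lists. *)
  move=> N; set eps' := Rmin eps (L - 1).
  have e'0 : eps' > 0 by apply: Rmin_pos; lra.
  have [N1 H1] := cL eps' e'0; set n := maxn N1 (i N).
  have := H1 n; rewrite /Rdist => /(_ (elimT ssrnat.leP (leq_maxl _ _))) /Rabs_def2[_ h].
  have S0' := INR_gt0 (leq_ltn_trans (leq0n n) (S_gt n re0)).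
  have r1 : 1 < ratio l0 e0 n by have := Rmin_r eps (L - 1); rewrite -/eps'; lra.
  have ST : (S l0 n <= T e0 n)%N.
    rewrite leqNgt; apply/negP => lt; have lt' := INR_leq (ltnW lt).
    have : ratio l0 e0 n <= 1; last by lra.
    apply: (Rmult_le_reg_r (INR (S l0 n))) => //.
    rewrite /ratio /Rdiv Rmult_assoc Rinv_l ?Rmult_1_r; lra.
  have [k [ik jk]] := root_block re0 ST; exists k; split.
    rewrite leqNgt; apply/negP => /i_mono; rewrite ik ltnNge.
    by rewrite (leq_trans (leq_maxr N1 (i N))) // ltnW //; apply: S_gt re0.
  rewrite ik jk; have := Rmin_l eps (L - 1); rewrite -/eps' /= => h'.
  by rewrite /ratio in h; lra.
exists 1; split=> // eps eps0; split.
  have [S0 HS0] := @far_ratio (eps / 2) ltac:(lra).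
  apply: (@limsup_upper 1 eps S0) => //; first by lra.
    by move=> l e n re le; have := HS0 l e n re le; lra.
  move=> l x _ Ax; have [//|lt] := Rle_lt_dec x 1; by case: no; exists l, x.
(* Index [N.+1] because block 0 may start at position 0. *)
move=> N; exists N.+1; split; first exact: leqnSn.
have i0 := INR_gt0 (leq_ltn_trans (leq0n _) (i_ge N.+1)).
have h := INR_leq (ij N.+1).
suff : 1 <= INR (j N.+1) / INR (i N.+1) by lra.
apply: (Rmult_le_reg_r (INR (i N.+1))) => //.
rewrite /Rdiv Rmult_assoc Rinv_l ?Rmult_1_r; lra.
Qed.

End Limsup.

(** * Limits along one line of descent *)

Section GapLimits.
Variables (Sigma : finType) (g : Sigma -> seq Sigma) (w : nat -> Sigma).
Hypothesis fixw : forall n, morph_word g (mkseq w n) = mkseq w (size (morph_word g (mkseq w n))).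
Hypothesis g_gt0 : forall c, 0 < size (g c).
Hypothesis g_gt1 : 1 < size (g (w 0)).
Hypothesis idem : forall Gamma c, ofirst Gamma (morph_word g (g c)) = ofirst Gamma (g c).
Hypothesis idem_rev : forall Gamma c,
  ofirst Gamma (rev (morph_word g (g c))) = ofirst Gamma (rev (g c)).
Variable Delta : {set Sigma}.
Hypothesis inf_out : forall N, exists n, N <= n /\ w n \notin Delta.

Let D := preim_sub g Delta.

Lemma all_idem (Gamma : {set Sigma}) c : all (mem Gamma) (morph_word g (g c)) = all (mem Gamma) (g c).
Proof. by rewrite -!ofirst_None idem. Qed.

(** A word contains [e] unless it is over the complement of [e]; idempotence for that subalphabet
    equates the letters of [g c] and [g (g c)]. *)
Lemma letters_trans c d e : d \in g c -> e \in g d -> e \in g c.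
Proof.
have memE s : (e \in s) = ~~ all (mem (~: [set e])) s.
  apply/idP/allPn => [es|[x xs]]; first by exists e; rewrite ?inE ?eqxx.
  by rewrite !inE negbK => /eqP <-.
move=> dc ed; rewrite memE -all_idem -memE.
by apply/flattenP; exists (g d) => //; apply: map_f.
Qed.

(** The left side asks that [g (g c)] be over [Delta], which by idempotence says the same of
    [g c]. *)
Lemma preim_sub_idem : preim_sub g D = D.
Proof.
apply/setP => c; rewrite /D inE [in RHS]inE -[RHS]all_idem all_morph_word.
by apply: eq_all => d; rewrite /= inE.
Qed.

Lemma mem_D c : (c \in D) = all (mem D) (g c).
Proof. by rewrite -{1}preim_sub_idem inE. Qed.

Lemma w_stepF q : w q \notin D -> w (stepF g w D q) = nth (w 0) (g (w q)) (fst_out D (g (w q))).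
Proof.
rewrite mem_D => h; have [lt _ _] := fst_outP (w 0) h.
by rewrite /stepF /step w_pos.
Qed.

Lemma w_stepL q : w q \notin D -> w (stepL g w D q) = nth (w 0) (g (w q)) (lst_out D (g (w q))).
Proof.
rewrite mem_D => h; have [lt _ _] := lst_outP (w 0) h.
by rewrite /stepL /step w_pos.
Qed.

Lemma stepF_letter q n : w q \notin D ->
  w (iter n (stepF g w D) (stepF g w D q)) = w (stepF g w D q).
Proof.
move=> wq; set c := w (stepF g w D q).
have cE : c = nth (w 0) (g (w q)) (fst_out D (g (w q))) by rewrite /c w_stepF.
have fixc : nth (w 0) (g c) (fst_out D (g c)) = c.
  by rewrite cE; apply: first_out_idem => // d; rewrite ?mem_D ?idem.
have cD : c \notin D.
  by rewrite cE; move: wq; rewrite mem_D => /(fst_outP (w 0))[].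
by elim: n => //= n IH; rewrite w_stepF IH.
Qed.

Lemma stepL_letter q n : w q \notin D ->
  w (iter n (stepL g w D) (stepL g w D q)) = w (stepL g w D q).
Proof.
move=> wq; set c := w (stepL g w D q).
have cE : c = nth (w 0) (g (w q)) (lst_out D (g (w q))) by rewrite /c w_stepL.
have cD : c \notin D.
  by rewrite cE; move: wq; rewrite mem_D => /(lst_outP (w 0))[].
have fixc : nth (w 0) (g c) (lst_out D (g c)) = c.
  rewrite nth_lst_out -?mem_D // {2 3}cE nth_lst_out -?mem_D //.
  rewrite -!/(rev_morph g _) cE nth_lst_out -?mem_D //.
  apply: first_out_idem => // d.
    by rewrite mem_D /rev_morph all_rev.
  by rewrite -rev_morph_word idem_rev.
by elim: n => //= n IH; rewrite w_stepL IH.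
Qed.

(** The case at issue is [l = 0]. Letters outside [Delta] recur, so some letter outside [D] has a
    positive position; following its ancestors down to the image of [w 0] finds one at a positive
    index of [g (w 0)]. *)
Lemma stepL_gt0 l : w l \notin D -> 0 < stepL g w D l.
Proof.
case: l => [|l] wl; last by rewrite /stepL /step (leq_trans _ (leq_addr _ _)) // (leq_trans _ (pos_ge g_gt0 g_gt1 _)).
have [q [q0 wq]] : exists q, 0 < q /\ w q \notin D.
  have [n [le wn]] := inf_out (size (g (w 0))).
  have [q [k [kq en]]] := parent w g_gt0 n.
  exists q; split.
    case: q kq en => // kq en; move: le; rewrite en /pos /= leqNgt /=.
    by rewrite add0n kq.
  apply: contra wn; rewrite /D inE => /(all_nthP (w 0)) h.
  by rewrite en w_pos //; apply: h.
have [m] := ubnP q; elim: m q q0 wq => // m IH q q0 wq lt.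
have [r [k [kr eq]]] := parent w g_gt0 q.
have wr : w r \notin D.
  apply: contra wq; rewrite mem_D => /(all_nthP (w 0)) h.
  by rewrite eq w_pos //; apply: h.
case: (posnP r) => [r0|r0]; last first.
  by apply: (IH r r0 wr); have := pos_gt g_gt0 g_gt1 r0; lia.
subst r; have := wr; rewrite mem_D => /(lst_outP (w 0))[l1 _ l3].
rewrite /stepL /step ltn_addl // lt0n; apply/negP => /eqP e.
have := l3 k; rewrite e kr andbT.
have -> : 0 < k by move: q0; rewrite eq /pos.
by move=> /(_ isT); apply/negP; rewrite -w_pos // -eq.
Qed.

(** Only the last image is taken with [Delta]. The [.+1] here and the [.-1] below pass from
    delimiters to block ends, so an empty block has [T e n < S l n]. *)
Let S l n := (stepL g w Delta (iter n (stepL g w D) l)).+1.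
Let T e n := (stepF g w Delta (iter n (stepF g w D) e)).-1.

Lemma final_gap l e n : gap w D l e -> gap w Delta (S l n).-1 (T e n).+1.
Proof.
move=> ge; have gi := gap_iter fixw g_gt0 n preim_sub_idem ge.
have gf := gap_image fixw g_gt0 gi.
by rewrite /S /T /= prednK //; case: gf; lia.
Qed.

Lemma S_lower l n : len g n.+1 (mkseq w l) < S l n.
Proof. by rewrite ltnS; apply: chain_lower. Qed.

Lemma fst_out_lt e : w e \notin D -> fst_out D (g (w e)) < size (g (w e)) /\
  fst_out Delta (g (w e)) < size (g (w e)).
Proof.
move=> we; split; first by move: we; rewrite mem_D => /(fst_outP (w 0))[].
by move: we; rewrite /D inE => /(fst_outP (w 0))[].
Qed.

Lemma T_upper l e n : gap w D l e -> T e n < len g n.+1 (mkseq w e.+1).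
Proof.
move=> ge; apply: leq_ltn_trans (leq_pred _) _.
have we k : w (iter k (stepF g w D) e) \notin D.
  by have [] := gap_iter fixw g_gt0 k preim_sub_idem ge.
apply: chain_upper => //; last by case: (fst_out_lt (we n)).
by move=> c /mapP[k _ ->]; case: (fst_out_lt (we k)).
Qed.

Lemma S_gt l e n : gap w D l e -> n < S l n.
Proof.
move=> [_ wl _ _].
have big k m : 0 < k -> m < S k m.
  move=> k0; apply: leq_ltn_trans (S_lower k m).
  apply: leq_trans (len_mkseq_mono g w m.+1 k0).
  by apply/ltnW/ltnW/(len_gt fixw g_gt0 g_gt1).
case: n => // n; have -> : S l n.+1 = S (stepL g w D l) n by rewrite /S iterSr.
apply: leq_ltn_trans (S_lower _ _); apply: leq_trans (len_mkseq_mono g w n.+1 (stepL_gt0 wl)).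
by apply/ltnW/(len_gt fixw g_gt0 g_gt1).
Qed.

Lemma gap_limit l e : gap w D l e -> exists xi : R,
  [/\ Un_cv (fun n => Rdiv (INR (T e n)) (INR (S l n))) xi,
      algebraic_deg_le xi #|Sigma| & uniform_morph g -> is_rational xi].
Proof.
move=> ge; have [_ wl we _] := ge.
(* From the first image on, the end letters are stable and the prefix before the left end is
   nonempty. *)
set l1 := stepL g w D l; set e1 := stepF g w D e.
have g1 : gap w D l1 e1 by exact: (gap_iter fixw g_gt0 1 preim_sub_idem ge).
have l1_gt0 : 0 < l1 by apply: stepL_gt0.
pose K0 := \max_c size (g c).
have gK c : size (g c) <= K0 by apply: (leq_bigmax c).
have [K' HK'] := len_growth fixw g_gt0 g_gt1 gK e1.+1.
have aS : affine_len g (S l1) (morph_word g (mkseq w l1))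
    (morph_word g (take (lst_out D (g (w l1))) (g (w l1)))).
  have H : affine_len g (fun n => stepL g w Delta (iter n (stepL g w D) l1))
      (morph_word g (mkseq w l1)) (morph_word g (take (lst_out D (g (w l1))) (g (w l1)))).
    exact: (chain_affine fixw _ (fun c => leq_subr _ _) (fun n => stepL_letter n wl)).
  by move=> n; have := H n; rewrite /S; lia.
have gT n : 0 < stepF g w Delta (iter n (stepF g w D) e1).
  have [lt _ _ _] := gap_image fixw g_gt0 (gap_iter fixw g_gt0 n preim_sub_idem g1).
  by apply: leq_ltn_trans lt.
have aT : affine_len g (T e1) (morph_word g (mkseq w e1))
    (morph_word g (take (fst_out D (g (w e1))) (g (w e1)))).
  have H : affine_len g (fun n => stepF g w Delta (iter n (stepF g w D) e1))
      (morph_word g (mkseq w e1)) (morph_word g (take (fst_out D (g (w e1))) (g (w e1)))).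
    exact: (chain_affine fixw _ (fun c => find_size _ _) (fun n => stepF_letter n we)).
  by move=> n; have := H n; have := gT n; have := gT n.+1; rewrite /T; lia.
(* [K'] bounds [T] by [S]; conversely [S <= T + 1] and [S >= 2] give [S <= 2 * T]. *)
have [||n|n|xi [cv al ra]] := affine_len_ratio (K := K' + 2) _ letters_trans aS aT.
- by apply/card_gt0P; exists (w 0).
- by [].
- apply: ltnW; apply: leq_trans (T_upper n g1) _.
  apply: leq_trans (HK' _) _; apply: leq_mul; first by rewrite leq_addr.
  apply: ltnW; apply: leq_ltn_trans (S_lower l1 n).
  exact: (len_mkseq_mono g w n.+1 l1_gt0).
- have [lt _ _ _] := final_gap n g1.
  have : 0 < len g n.+1 (mkseq w l1).
    apply: leq_trans (len_mkseq_mono g w n.+1 l1_gt0).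
    by apply: leq_ltn_trans (len_gt fixw g_gt0 g_gt1 n.+1).
  by have := S_lower l1 n; nia.
exists xi; split=> //; apply: (@Un_cv_unshift _ 1) => eps /cv[N HN].
by exists N => n /HN; rewrite /S /T /l1 /e1 -!iterSr.
Qed.

End GapLimits.

(** * Return to maximal blocks *)

Lemma max_block_gap (Sigma : finType) (w : nat -> Sigma) (Delta : {set Sigma}) i j :
  0 < i -> max_block w Delta i j <-> i <= j /\ gap w Delta i.-1 j.+1.
Proof.
move=> i0; split=> [[le [btw [wj wi]]]|[le [lt wi wj btw]]]; split=> //.
  split=> //; first by lia.
    by case: wi => // e; rewrite e in i0.
  by move=> t ht; apply: btw; lia.
split; first by move=> t ht; apply: btw; lia.
by split=> //; right.
Qed.

Theorem theorem8 (Sigma : finType) (h : Sigma -> seq Sigma) (a : Sigma)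
  (Delta : {set Sigma}) (i j : nat -> nat) :
  nonerasing h ->
  prolongable h a ->
  Delta != set0 ->
  Delta \proper [set: Sigma] ->
  (forall N, exists n, N <= n /\ fixpoint_word h a n \notin Delta) ->
  (forall L, exists s, forall t, t < L -> fixpoint_word h a (s + t) \in Delta) ->
  enum_max_blocks (fixpoint_word h a) Delta i j ->
  exists L : R,
    is_limsup (fun k => Rdiv (INR (j k)) (INR (i k))) L /\
    algebraic_deg_le L #|Sigma| /\
    (uniform_morph h -> is_rational L).
Proof.
move=> ne pr _ _ inf_out _ [i_incr [blk all_blk]].
set w := fixpoint_word h a in inf_out blk all_blk.
have [p p0 idem] := idempotent_power h.
pose g c := morph_iter h p [:: c].
have gE s : morph_word g s = morph_iter h p s.
  elim: s => [|c s IH]; last by rewrite -cat1s morph_iter_cat -IH.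
  by rewrite /morph_iter; elim: (p) => // n; rewrite iterSr.
have ggE c : morph_word g (g c) = morph_iter h (p + p) [:: c].
  by rewrite gE /g /morph_iter -iterD.
have w0 : w 0 = a by have := morph_iter_fixpoint pr 0; rewrite -/w => -[].
have fixw n : morph_word g (mkseq w n) = mkseq w (size (morph_word g (mkseq w n))).
  rewrite gE; elim: (p) => [|q IH]; first by rewrite /= size_mkseq.
  by rewrite /morph_iter iterS -/(morph_iter h q _) IH; apply: morph_word_fixpoint.
have g_gt0 c : 0 < size (g c).
  suff H q s : size s <= size (morph_iter h q s) by apply: (H p [:: c]).
  elim: q => // q IH; apply: leq_trans IH _; rewrite /morph_iter iterS.
  elim: (iter q _ s) => // d t IHt; rewrite /morph_word /= size_cat -add1n leq_add //.
  by have := ne d; case: (h d).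
have g_gt1 : 1 < size (g (w 0)).
  by rewrite w0; apply: leq_ltn_trans (size_morph_iter_prolong pr p).
have idem1 (Gamma : {set Sigma}) c : ofirst Gamma (morph_word g (g c)) = ofirst Gamma (g c).
  by rewrite ggE; case: (idem Gamma c).
have idem2 (Gamma : {set Sigma}) c :
    ofirst Gamma (rev (morph_word g (g c))) = ofirst Gamma (rev (g c)).
  by rewrite ggE; case: (idem Gamma c).
set D := preim_sub g Delta.
have eD : preim_sub g D = D := preim_sub_idem idem1 Delta.
pose K := \max_c size (g c).
have gK c : size (g c) <= K by apply: (leq_bigmax c).
have ij k : i k <= j k by case: (blk k).
pose S l n := (stepL g w Delta (iter n (stepL g w D) l)).+1.
pose T e n := (stepF g w Delta (iter n (stepF g w D) e)).-1.
pose root l e := gap w D l e /\ e < l + K.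
have next_uniq l e e' : gap w D l e -> gap w D l e' -> e = e'.
  move=> [lt _ we btw] [lt' _ we' btw']; apply/eqP; rewrite eqn_leq.
  apply/andP; split; rewrite leqNgt; apply/negP => h'.
    by move: we'; rewrite btw // lt'.
  by move: we; rewrite btw' // lt.
suff [L [limL [algL ratL]]] : exists L, is_limsup (fun k => Rdiv (INR (j k)) (INR (i k))) L /\
    (algebraic_deg_le L #|Sigma| /\ (uniform_morph g -> is_rational L)).
  exists L; split=> //; split=> // -[m hm]; apply: ratL; exists (m ^ p) => c.
  rewrite /g; elim: (p) => // q IH; rewrite /morph_iter iterS -/(morph_iter h q _) expnS -IH.
  by elim: (morph_iter h q [:: c]) => [|d s IHs]; rewrite ?muln0 // /morph_word /= size_cat hm mulnS IHs.
(* [K.+1] bounds both the short blocks and the extent [e.+1 - l] of a root gap. *)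
apply: (@limsup_blocks i j root S T K.+1 i_incr ij).
- by move=> l e e' [ge _] [ge' _]; apply: next_uniq ge ge'.
- move=> k ik; have [small|big] := leqP (j k) (i k + K.+1); first by left.
  right; have [_ gk] := proj1 (max_block_gap _ _ _ ik) (blk k).
  (* One descent turns the [Delta]-gap around the block into a [D]-gap, where [gap_root] takes
     over. *)
  have [|l1 [e1 [g1 el ee _]]] := gap_parent fixw g_gt0 g_gt1 gK gk; first by lia.
  have [l0 [e0 [n [g0 s0 l1E e1E]]]] := gap_root fixw g_gt0 g_gt1 gK eD g1.
  exists l0, e0, n; split=> //.
    by rewrite /S -l1E -el prednK.
  by rewrite /T -e1E -ee.
- move=> l e n [ge _] ST.
  have gf := final_gap fixw g_gt0 g_gt1 idem1 n ge.
  have /all_blk[k [ik jk]] : max_block w Delta (S l n) (T e n).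
    by apply/max_block_gap.
  by exists k.
- by move=> l e n [ge _]; apply: (S_gt fixw g_gt0 g_gt1 idem1 inf_out n ge).
- move=> C; have [S0 HS0] := far_segment_small g w C.
  exists S0 => l e n [ge lt] le.
  have tu := T_upper fixw g_gt0 idem1 n ge.
  have sl := S_lower fixw Delta l n.
  have := HS0 l (e.+1 - l) n.+1 le; rewrite subnKC; last by case: ge; lia.
  move=> h1; apply: leq_trans (_ : C * len g n.+1 (mkseq w e.+1) <= _).
    by rewrite leq_mul2l ltnW ?orbT.
  apply: leq_trans h1 _; apply: leq_mul; first by lia.
  exact: ltnW.
- split; last by move=> _; apply: is_rational1.
  by apply/algebraic_deg_le1/card_gt0P; exists a.
move=> l e [ge _].
have [xi [cv al ra]] := gap_limit fixw g_gt0 g_gt1 idem1 idem2 inf_out ge.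
by exists xi.
Qed.
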